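(* Let $n\in\mathbb N$ and $H>0$. There exists a constant $C(H)>0$, depending only on $H$, such that the following holds for any quadruplet $q=(a,b,c,d)\in\mathcal Q_n$ satisfying $|||q|||\le H$. Put $p_0=a^2+b^2w$, $p_1=1-c^2-d^2w$ and $(\tilde a,\tilde b,\tilde c,\tilde d)=\Pi_n(q)$. Then the polynomial with two bounds $$\tilde p:=\tilde a^2+\tilde b^2w=1-\tilde c^2-\tilde d^2w\ \in U_{2n}$$ satisfies $$\|p_0-\tilde p\|\ \le\ (n+1)\,C(H)\,\max\left\{\|p_0-p_1\|,\ \|p_0-p_1\|^{2^{-(2n+1)}}\right\}.$$
   Context: **Polynomials and quadruplets.** $\mathbb N=\{0,1,2,\dots\}$. $P_n$ is the set of real univariate polynomials of degree at most $n$, with $P_{-1}=\{0\}$; $w(x)=x(1-x)$. $U_{2n}=\{p\in P_{2n}: 0\le p(x)\le1\text{ for all }x\in[0,1]\}$. Put $\mathcal Q_n=P_n\times P_{n-1}\times P_n\times P_{n-1}$ and $\mathcal Q_\infty=\bigcup_n\mathcal Q_n$, with componentwise addition and real scalar multiplication. For $q=(a,b,c,d)$ let $M(q)=a^2+b^2w+c^2+d^2w$ (for $q\in\mathcal Q_n$, $M(q)\in P_{2n}$), $\overline q=(a,-b,-c,-d)$, and $\mathcal U_n=\{q\in\mathcal Q_n: M(q)=1\}$. The product of $r=(\alpha,\beta,\gamma,\delta)$ and $q=(a,b,c,d)$ is $rq=(A,B,C,D)$ with $A=\alpha a-\beta bw-\gamma c-\delta dw$, $B=\beta a+\alpha b-\delta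 c+\gamma d$, $C=\gamma a+\delta bw+\alpha c-\beta dw$, $D=\delta a-\gamma b+\beta c+\alpha d$ (an associative product). **Norms.** For a polynomial $p$, $\|p\|=\int_0^1|p(x)|\,w(x)^{-1/2}\,dx$. For $q\in\mathcal Q_n$, $|||q|||=\|M(q)\|^{1/2}$. **Chebyshev coefficients.** $T_n$ and the Chebyshev polynomials of the second kind, denoted $U_n$ (a single polynomial, not to be confused with the set $U_{2n}$), are the polynomials with $T_n\big(\frac{\cos\theta+1}2\big)=\cos(n\theta)$ and $U_n\big(\frac{\cos\theta+1}2\big)=\frac{2\sin(n\theta)}{\sin\theta}$ (degrees $n$ and $n-1$). For $(a,b,c,d)\in\mathcal Q_n$ write $a=\sum_{i=0}^na_iT_i$, $c=\sum_{i=0}^nc_iT_i$, $b=\sum_{i=1}^nb_iU_i$, $d=\sum_{i=1}^nd_iU_i$; and write $M(q)=\sum_{i=0}^{2n}M(q)_iT_i$. For $n\ge1$ let $\mathcal U_n^{(1)}=\{q\in\mathcal Q_n: M(q)_{2n}=M(q)_{2n-1}=0\}$. **Correction functions $\chi_n:\mathcal Q_n\to\mathcal U_n^{(1)}$.** Let $S=\begin{pmatrix}1&0\\0&0\end{pmatrix}$, $T=\begin{pmatrix}0&1\\1&0\end{pmatrix}$. *Case $n\ge2$.* Let $A=\mathrm{diag}(S,-S,S,-S)$ and $B=\mathrm{diag}(T,-T,T,-T)$ (block diagonal $8\times8$ matrices), $M_{\lambda,\mu}=I+\lambda A+\mu B$, $\mathcal D=\{(\lambda,\mu)\in\mathbb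 R^2: M_{\lambda,\mu}>0\}=\{|\lambda|+\mu^2<1\}$ and $G_X(\lambda,\mu)=X^tM_{\lambda,\mu}^{-1}X$ for $X\in\mathbb R^8$. Label the coordinates of $X\in\mathbb R^8$ as $(a_n,a_{n-1},b_n,b_{n-1},c_n,c_{n-1},d_n,d_{n-1})$ and let $\mathcal S=\{X: a_nc_{n-1}\ne a_{n-1}c_n,\ b_nd_{n-1}\ne b_{n-1}d_n\}$, an open dense set; for $X\in\mathcal S$, $G_X$ attains its infimum on $\mathcal D$. For $X\in\mathcal S$ put $\chi(X)=M_{\lambda^*,\mu^*}^{-1}X$ where $(\lambda^*,\mu^* )\in\mathcal D$ is a (chosen) global minimizer of $G_X$ on $\mathcal D$. For $X\notin\mathcal S$, $\chi(X)$ is defined by perturbation: $\chi(X)$ is a (chosen) limit of a convergent sequence $\chi(X_k)$ with $X_k\in\mathcal S$, $X_k\to X$. Then $\chi_n(a,b,c,d)=(\hat a,\hat b,\hat c,\hat d)$, where the Chebyshev coefficients of index $\le n-2$ are unchanged and $(\hat a_n,\hat a_{n-1},\hat b_n,\hat b_{n-1},\hat c_n,\hat c_{n-1},\hat d_n,\hat d_{n-1})=\chi(a_n,a_{n-1},b_n,b_{n-1},c_n,c_{n-1},d_n,d_{n-1})$. *Case $n=1$.* Let $\tilde A=\mathrm{diag}(S,-1,S,-1)$, $\tilde B=\mathrm{diag}(T,0,T,0)$ ($6\times6$), $\tilde M_{\lambda,\mu}=I+\lambda\tilde A+\mu\tilde B$, $\tilde{\mathcal D}=\{\mu^2-1<\lambda<1\}$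 (the set where $\tilde M_{\lambda,\mu}>0$), $\tilde G_X(\lambda,\mu)=X^t\tilde M_{\lambda,\mu}^{-1}X$ for $X=(a_1,a_0,b_1,c_1,c_0,d_1)\in\mathbb R^6$. On the open dense set $\tilde{\mathcal S}=\{a_1c_0\ne a_0c_1,\ (b_1,d_1)\neq(0,0)\}$ put $\tilde\chi(X)=\tilde M_{\lambda^*,\mu^*}^{-1}X$ with $(\lambda^*,\mu^* )$ a (chosen) global minimizer of $\tilde G_X$ on $\tilde{\mathcal D}$; outside $\tilde{\mathcal S}$, $\tilde\chi(X)$ is a (chosen) limit of a convergent sequence $\tilde\chi(X_k)$ with $X_k\in\tilde{\mathcal S}$, $X_k\to X$. Then $\chi_1(a,b,c,d)=(\hat a_1T_1+\hat a_0,\hat b_1U_1,\hat c_1T_1+\hat c_0,\hat d_1U_1)$ with $(\hat a_1,\hat a_0,\hat b_1,\hat c_1,\hat c_0,\hat d_1)=\tilde\chi(a_1,a_0,b_1,c_1,c_0,d_1)$. **Factorization functions $\phi_n:\mathcal U_n^{(1)}\to\mathcal U_1$, $n\ge1$.** Let $\hat q=(\hat a,\hat b,\hat c,\hat d)\in\mathcal U_n^{(1)}$. If $\hat a_n^2+\hat c_n^2=0$, $\phi_n(\hat q)=(1,0,0,0)$. Otherwise: for $n=1$, $\phi_1(\hat q)=K\,\overline{\hat q}$ with $K=M(\hat q)^{-1/2}$ ($M(\hat q)$ being a positive constant); for $n\ge2$, $\phi_n(\hat q)=K(\alpha_1T_1+\alpha_0,\ \beta_1U_1,\ \gamma_1T_1+\gamma_0,\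 \delta_1U_1)$ with $\alpha_1=\hat a_n$, $\beta_1=-\hat b_n$, $\gamma_1=-\hat c_n$, $\delta_1=-\hat d_n$, $$\alpha_0=\frac{\hat a_{n-1}}2-\frac{\hat b_n\hat b_{n-1}+\hat d_n\hat d_{n-1}}{2(\hat a_n^2+\hat c_n^2)}\hat a_n+\frac{\hat b_n\hat d_{n-1}-\hat d_n\hat b_{n-1}}{2(\hat a_n^2+\hat c_n^2)}\hat c_n,$$ $$\gamma_0=-\frac{\hat c_{n-1}}2+\frac{\hat b_n\hat b_{n-1}+\hat d_n\hat d_{n-1}}{2(\hat a_n^2+\hat c_n^2)}\hat c_n+\frac{\hat b_n\hat d_{n-1}-\hat d_n\hat b_{n-1}}{2(\hat a_n^2+\hat c_n^2)}\hat a_n,$$ $K=\big(\alpha_0^2+\gamma_0^2+\tfrac12(\alpha_1^2+\beta_1^2+\gamma_1^2+\delta_1^2)\big)^{-1/2}$. One has $\phi_n(\hat q)\hat q\in\mathcal Q_{n-1}$. **Projection $\Pi_n:\mathcal Q_n\to\mathcal U_n$.** Given $q\in\mathcal Q_n$, set $q_n=q$ and for $i=0,\dots,n-1$: $\hat q_{n-i}=\chi_{n-i}(q_{n-i})\in\mathcal U_{n-i}^{(1)}$, $e_{i+1}=\phi_{n-i}(\hat q_{n-i})\in\mathcal U_1$, $q_{n-(i+1)}=e_{i+1}\hat q_{n-i}\in\mathcal Q_{n-(i+1)}$. Let $r_0=q_0/M(q_0)^{1/2}$ if $q_0\ne0$ ($M(q_0)$ is a constant) and $r_0=(1,0,0,0)$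 otherwise. Then $\Pi_n(q)=\overline{e_1}\,\overline{e_2}\cdots\overline{e_n}\,r_0$. Here the choices of minimizers (and limits) in the correction functions are arbitrary but fixed. *)

(* Defs.v *)
From HB Require Import structures.
From mathcomp Require Import all_boot all_order all_algebra ring lra.
From mathcomp Require Import all_classical all_reals all_analysis.

Set Implicit Arguments.
Unset Strict Implicit.
Unset Printing Implicit Defensive.

Import Order.TTheory GRing.Theory Num.Theory.
Import numFieldNormedType.Exports.

Local Open Scope classical_set_scope.
Local Open Scope ring_scope.

Section Polynomials.
Context {R : realType}.
Implicit Types (p : {poly R}) (n : nat) (t : R).

Definition w : {poly R} := 'X * (1 - 'X).

(* The integrand is 0 at the endpoints, where MathComp's 0^-1 = 0 applies. *)
Definition wnorm p : R :=
  \int[lebesgue_measure]_(x in `[0%R, 1%R]) (`|p.[x]| * (Num.sqrt w.[x])^-1).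

Definition two_bounds n p : Prop :=
  (size p <= n.+1)%N /\ (forall x : R, 0 <= x <= 1 -> 0 <= p.[x] <= 1).

(* Chebyshev polynomials on [0, 1], defined by their three-term recurrences;
   chebT_cos, chebT_unique, chebU_sin and chebU_unique show that these are
   exactly the polynomials determined by the trigonometric identities. *)
Fixpoint chebT n : {poly R} :=
  match n with
  | 0 => 1
  | 1 => 2 *: 'X - 1
  | (m.+1 as m').+1 => 2 *: ((2 *: 'X - 1) * chebT m') - chebT m
  end.

Fixpoint chebU n : {poly R} :=
  match n with
  | 0 => 0
  | 1 => 2%:P
  | (m.+1 as m').+1 => 2 *: ((2 *: 'X - 1) * chebU m') - chebU m
  end.

Lemma chebTSS n :
  chebT n.+2 = 2 *: ((2 *: 'X - 1) * chebT n.+1) - chebT n.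
Proof. by []. Qed.

Lemma chebUSS n :
  chebU n.+2 = 2 *: ((2 *: 'X - 1) * chebU n.+1) - chebU n.
Proof. by []. Qed.

Lemma nat_ind2 (P : nat -> Prop) :
  P 0%N -> P 1%N -> (forall n, P n -> P n.+1 -> P n.+2) -> forall n, P n.
Proof.
move=> P0 P1 PS n; suff [] : P n /\ P n.+1 by [].
by elim: n => // n [Pn Pn1]; split=> //; apply: PS.
Qed.

Let lin_horner (x : R) : (2 *: 'X - 1 : {poly R}).[x] = 2 * x - 1.
Proof. by rewrite hornerD hornerN hornerZ hornerX -polyC1 hornerC. Qed.

Let rec_horner p (q : {poly R}) (x : R) :
  (2 *: ((2 *: 'X - 1) * p) - q).[x] = 2 * ((2 * x - 1) * p.[x]) - q.[x].
Proof. by rewrite hornerD hornerN hornerZ hornerM lin_horner. Qed.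

Lemma chebT_cos n t : (chebT n).[(cos t + 1) / 2] = cos (n%:R * t).
Proof.
elim/nat_ind2: n => [||n IH0 IH1].
- by rewrite mul0r cos0 /= hornerE.
- by rewrite mul1r /= lin_horner; field.
rewrite chebTSS rec_horner IH0 IH1.
have -> : n.+2%:R * t = n.+1%:R * t + t by rewrite -(natr1 n.+1); ring.
have -> : n%:R * t = n.+1%:R * t - t by rewrite -(natr1 n); ring.
by rewrite !cosD cosN sinN; field.
Qed.

Lemma chebU_sin n t :
  (chebU n).[(cos t + 1) / 2] * sin t = 2 * sin (n%:R * t).
Proof.
elim/nat_ind2: n => [||n IH0 IH1].
- by rewrite /= [0%:R * t]mul0r sin0 horner0 mul0r mulr0.
- by rewrite mul1r /= hornerC.
rewrite chebUSS rec_horner.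
set u1 := (chebU n.+1).[_] in IH1 *; set u0 := (chebU n).[_] in IH0 *.
have -> : n.+2%:R * t = n.+1%:R * t + t by rewrite -(natr1 n.+1); ring.
have e0 : n%:R * t = n.+1%:R * t - t by rewrite -(natr1 n); ring.
transitivity (2 * cos t * (u1 * sin t) - u0 * sin t); first by field.
by rewrite IH0 IH1 e0 !sinD cosN sinN; field.
Qed.

Lemma poly_eq_unit_itv (p q : {poly R}) :
  (forall x : R, 0 < x < 1 -> p.[x] = q.[x]) -> p = q.
Proof.
move=> pq; apply/eqP; rewrite -subr_eq0; apply/negPn/negP => nz.
pose s := [seq (k.+2%:R^-1 : R) | k <- iota 0 (size (p - q))].
have us : uniq s.
  rewrite map_inj_uniq ?iota_uniq // => i j /invr_inj /eqP.
  by rewrite eqr_nat => /eqP [].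
have rs : all (root (p - q)) s.
  apply/allP => _ /mapP[k _ ->]; rewrite rootE !hornerE pq ?subrr //.
  by rewrite invr_gt0 ltr0n /= invf_lt1 ?ltr1n ?ltr0n.
by have := max_poly_roots nz rs us; rewrite size_map size_iota ltnn.
Qed.

Lemma unit_itv_cos (x : R) :
  0 < x < 1 -> exists2 t, x = (cos t + 1) / 2 & sin t != 0.
Proof.
move=> x01; exists (acos (2 * x - 1)); first by rewrite acosK; [field|rewrite in_itv /=; lra].
by rewrite sin_acos; [apply: lt0r_neq0; rewrite sqrtr_gt0; nra|lra].
Qed.

Lemma chebT_unique n p :
  (forall t, p.[(cos t + 1) / 2] = cos (n%:R * t)) -> p = chebT n.
Proof.
by move=> pE; apply: poly_eq_unit_itv => _ /unit_itv_cos[t -> _]; rewrite pE chebT_cos.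
Qed.

Lemma chebU_unique n p :
  (forall t, p.[(cos t + 1) / 2] * sin t = 2 * sin (n%:R * t)) ->
  p = chebU n.
Proof.
move=> pE; apply: poly_eq_unit_itv => _ /unit_itv_cos[t -> st0].
by apply: (mulIf st0); rewrite pE chebU_sin.
Qed.

Let size_lin : size (2 *: 'X - 1 : {poly R}) = 2%N.
Proof.
by rewrite size_polyDl ?size_polyN ?size_poly1 size_scale ?size_polyX ?pnatr_eq0.
Qed.

Let size_step p (q : {poly R}) m : size p = m.+1 -> (size q <= m.+1)%N ->
  size (2 *: ((2 *: 'X - 1) * p) - q) = m.+2.
Proof.
move=> sp sq; have p0 : p != 0 by rewrite -size_poly_gt0 sp.
have l0 : (2 *: 'X - 1 : {poly R}) != 0 by rewrite -size_poly_gt0 size_lin.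
have s1 : size (2 *: ((2 *: 'X - 1) * p)) = m.+2.
  by rewrite size_scale ?pnatr_eq0 // size_mul // size_lin sp.
by rewrite size_polyDl ?size_polyN s1.
Qed.

Lemma size_chebT n : size (chebT n) = n.+1.
Proof.
elim/nat_ind2: n => [||n IH0 IH1]; first by rewrite size_poly1.
- exact: size_lin.
- by rewrite chebTSS; apply: size_step; rewrite ?IH0.
Qed.

Lemma size_chebU n : size (chebU n) = n.
Proof.
elim/nat_ind2: n => [||n IH0 IH1]; first by rewrite size_poly0.
- by rewrite size_polyC pnatr_eq0.
- by rewrite chebUSS; apply: size_step; rewrite ?IH0.
Qed.

(* The coordinates of p in the basis (F_i) of {poly R}, when size F_i = i + 1. *)
Definition basis_coef (F : nat -> {poly R}) p : nat -> R :=
  get [set u : nat -> R | p = \sum_(i < size p) u i *: F i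
                       /\ forall i, (size p <= i)%N -> u i = 0].

Lemma basis_ex (F : nat -> {poly R}) (sF : forall i, size (F i) = i.+1) n p :
  (size p <= n)%N -> exists u : nat -> R, p = \sum_(i < n) u i *: F i.
Proof.
elim: n p => [|n IH] p sp.
  exists (fun=> 0); rewrite big_ord0; apply/eqP.
  by rewrite -size_poly_eq0 -leqn0.
pose k := p`_n / (F n)`_n.
have Fn0 : (F n)`_n != 0.
  by have := sF n; rewrite -[n in (F n)`_n]/(n.+1.-1) => s; rewrite -{2}s -lead_coefE lead_coef_eq0 -size_poly_gt0 s.
have [|u pu] := IH (p - k *: F n).
  apply/leq_sizeP => j; rewrite leq_eqVlt => /orP[/eqP <-|nj].
    by rewrite coefB coefZ /k divfK // subrr.
  by rewrite coefB coefZ !nth_default ?mulr0 ?subrr ?sF // (leq_trans sp).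
exists (fun i => if i == n then k else u i).
rewrite big_ord_recr /= eqxx -[LHS](subrK (k *: F n)) pu; congr (_ + _).
by apply: eq_bigr => i _; rewrite ltn_eqF.
Qed.

Lemma basis_free (F : nat -> {poly R}) (sF : forall i, size (F i) = i.+1) n
    (u v : nat -> R) :
  \sum_(i < n) u i *: F i = \sum_(i < n) v i *: F i ->
  forall i, (i < n)%N -> u i = v i.
Proof.
elim: n => [//|n IH]; rewrite !big_ord_recr /= => E.
have Fn0 : (F n)`_n != 0.
  by have := sF n; rewrite -[n in (F n)`_n]/(n.+1.-1) => s; rewrite -{2}s -lead_coefE lead_coef_eq0 -size_poly_gt0 s.
have low (x : nat -> R) : (\sum_(i < n) x i *: F i)`_n = 0.
  by rewrite coef_sum big1 // => i _; rewrite coefZ nth_default ?mulr0 // sF.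
have uv : u n = v n.
  have /(congr1 (fun p : {poly R} => p`_n)) := E.
  by rewrite !coefD !low !add0r !coefZ => /(mulIf Fn0).
move: E; rewrite uv => /addIr /IH{}IH i.
by rewrite ltnS leq_eqVlt => /orP[/eqP -> //|/IH].
Qed.

Lemma basis_coef_sum (F : nat -> {poly R}) (sF : forall i, size (F i) = i.+1)
    n p :
  (size p <= n)%N -> p = \sum_(i < n) basis_coef F p i *: F i.
Proof.
move=> sp; have [] : [set u : nat -> R | p = \sum_(i < size p) u i *: F i
    /\ forall i, (size p <= i)%N -> u i = 0] (basis_coef F p).
  apply: xgetPex; have [u pu] := basis_ex sF (leqnn (size p)).
  exists (fun i => if (i < size p)%N then u i else 0); split.
    by rewrite {1}pu; apply: eq_bigr => i _; rewrite ltn_ord.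
  by move=> i; rewrite leqNgt => /negbTE ->.
move=> pE c0; rewrite {1}pE -!(big_mkord xpredT (fun i => basis_coef F p i *: F i)).
rewrite (big_cat_nat (leq0n _) sp) /=.
rewrite [X in _ = _ + X]big_nat_cond [X in _ = _ + X]big1 ?addr0 //.
by move=> i /andP[/andP[/c0 -> _] _]; rewrite scale0r.
Qed.

Definition Tcoef p : nat -> R := basis_coef chebT p.

(* Indices start at 1: p = \sum_(1 <= i < n.+1) Ucoef p i *: chebU i. *)
Definition Ucoef p (i : nat) : R := basis_coef (fun k => chebU k.+1) p i.-1.

Lemma Tcoef_sum n p :
  (size p <= n.+1)%N -> p = \sum_(0 <= i < n.+1) Tcoef p i *: chebT i.
Proof.
by move=> sp; rewrite big_mkord; apply: basis_coef_sum => //; apply: size_chebT.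
Qed.

Lemma Ucoef_sum n p :
  (size p <= n)%N -> p = \sum_(1 <= i < n.+1) Ucoef p i *: chebU i.
Proof.
move=> sp; rewrite big_add1 /= big_mkord; apply: basis_coef_sum => // i.
exact: size_chebU.
Qed.

End Polynomials.

Section Quadruplets.
Context {R : realType}.

Definition quad : Type := ({poly R} * {poly R} * {poly R} * {poly R})%type.

Implicit Types q r : quad.

Definition inQ (n : nat) q : Prop :=
  let: (a, b, c, d) := q in
  [/\ (size a <= n.+1)%N, (size b <= n)%N, (size c <= n.+1)%N
    & (size d <= n)%N].

Definition qM q : {poly R} :=
  let: (a, b, c, d) := q in a ^+ 2 + b ^+ 2 * w + c ^+ 2 + d ^+ 2 * w.

Definition qconj q : quad := let: (a, b, c, d) := q in (a, - b, - c, - d).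

Definition qone : quad := (1, 0, 0, 0).

Definition qmul r q : quad :=
  let: (al, be, ga, de) := r in
  let: (a, b, c, d) := q in
  (al * a - be * b * w - ga * c - de * d * w,
   be * a + al * b - de * c + ga * d,
   ga * a + de * b * w + al * c - be * d * w,
   de * a - ga * b + be * c + al * d).

Definition qnorm q : R := Num.sqrt (wnorm (qM q)).

End Quadruplets.

Arguments quad R : clear implicits.

Section Correction.
Context {R : realType}.

Section Pencil.
Variables (m : nat) (A B : 'M[R]_m) (S : set 'cV[R]_m).
Implicit Types (X : 'cV[R]_m) (lm : R * R).

Definition pencil lm : 'M[R]_m := 1%:M + lm.1 *: A + lm.2 *: B.

Definition posdef (N : 'M[R]_m) : Prop :=
  forall v : 'cV[R]_m, v != 0 -> 0 < (v^T *m N *m v) 0 0.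

Definition pencil_dom : set (R * R) := [set lm | posdef (pencil lm)].

Definition pencil_G X lm : R := (X^T *m invmx (pencil lm) *m X) 0 0.

Definition pencil_min X lm : Prop :=
  pencil_dom lm /\
  (forall lm', pencil_dom lm' -> pencil_G X lm <= pencil_G X lm').

(* chi is an admissible outcome of all the choices: of a global minimizer for
   each X in S, of a perturbation sequence (and limit) for each X outside S. *)
Definition correction (chi : 'cV[R]_m -> 'cV[R]_m) : Prop :=
  (forall X, S X ->
     exists2 lm, pencil_min X lm & chi X = invmx (pencil lm) *m X) /\
  (forall X, ~ S X ->
     exists Xk : nat -> 'cV[R]_m,
       [/\ forall k, S (Xk k), Xk k @[k --> \oo] --> X
         & chi (Xk k) @[k --> \oo] --> chi X]).

End Pencil.

Definition Smx : 'M[R]_2 := delta_mx 0 0.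
Definition Tmx : 'M[R]_2 := delta_mx 0 1 + delta_mx 1 0.

Definition diag2 m n (M : 'M[R]_m) (N : 'M[R]_n) : 'M[R]_(m + n) :=
  block_mx M 0 0 N.

Definition colv m (s : seq R) : 'cV[R]_m := \col_(i < m) s`_i.
Definition crd m (X : 'cV[R]_m.+1) (i : nat) : R := X (inord i) 0.

(* Coordinates (a_n, a_(n-1), b_n, b_(n-1), c_n, c_(n-1), d_n, d_(n-1)). *)
Definition A8 : 'M[R]_8 := diag2 (diag2 Smx (- Smx)) (diag2 Smx (- Smx)).
Definition B8 : 'M[R]_8 := diag2 (diag2 Tmx (- Tmx)) (diag2 Tmx (- Tmx)).
Definition S8 : set 'cV[R]_8 :=
  [set X | crd X 0 * crd X 5 != crd X 1 * crd X 4 /\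
           crd X 2 * crd X 7 != crd X 3 * crd X 6].

(* Coordinates (a_1, a_0, b_1, c_1, c_0, d_1). *)
Definition A6 : 'M[R]_6 :=
  diag2 (diag2 Smx (- 1%:M : 'M[R]_1)) (diag2 Smx (- 1%:M : 'M[R]_1)).
Definition B6 : 'M[R]_6 :=
  diag2 (diag2 Tmx (0 : 'M[R]_1)) (diag2 Tmx (0 : 'M[R]_1)).
Definition S6 : set 'cV[R]_6 :=
  [set X | crd X 0 * crd X 4 != crd X 1 * crd X 3 /\
           (crd X 2, crd X 5) != (0, 0)].

Definition top8 (n : nat) (q : quad R) : 'cV[R]_8 :=
  let: (a, b, c, d) := q in
  colv 8 [:: Tcoef a n; Tcoef a n.-1; Ucoef b n; Ucoef b n.-1;
             Tcoef c n; Tcoef c n.-1; Ucoef d n; Ucoef d n.-1].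

Definition top6 (q : quad R) : 'cV[R]_6 :=
  let: (a, b, c, d) := q in
  colv 6 [:: Tcoef a 1; Tcoef a 0; Ucoef b 1; Tcoef c 1; Tcoef c 0; Ucoef d 1].

Definition set_topT (n : nat) (p : {poly R}) (x y : R) : {poly R} :=
  \sum_(0 <= i < n.-1) Tcoef p i *: chebT i
  + y *: chebT n.-1 + x *: chebT n.

Definition set_topU (n : nat) (p : {poly R}) (x y : R) : {poly R} :=
  \sum_(1 <= i < n.-1) Ucoef p i *: chebU i
  + y *: chebU n.-1 + x *: chebU n.

Section Functions.
Variables (chi6 : 'cV[R]_6 -> 'cV[R]_6) (chi8 : 'cV[R]_8 -> 'cV[R]_8).

(* Only used for n >= 1. *)
Definition chi (n : nat) (q : quad R) : quad R :=
  match n with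
  | 0 => q
  | 1 =>
    let Y := chi6 (top6 q) in
    (crd Y 0 *: chebT 1 + (crd Y 1)%:P, crd Y 2 *: chebU 1,
     crd Y 3 *: chebT 1 + (crd Y 4)%:P, crd Y 5 *: chebU 1)
  | _ =>
    let: (a, b, c, d) := q in
    let Y := chi8 (top8 n q) in
    (set_topT n a (crd Y 0) (crd Y 1), set_topU n b (crd Y 2) (crd Y 3),
     set_topT n c (crd Y 4) (crd Y 5), set_topU n d (crd Y 6) (crd Y 7))
  end.

(* Only used for n >= 1 and qh with qM qh of degree at most 2 n - 2; when
   n = 1, qM qh is therefore constant. *)
Definition phi (n : nat) (qh : quad R) : quad R :=
  let: (a, b, c, d) := qh in
  let an := Tcoef a n in let an1 := Tcoef a n.-1 in
  let bn := Ucoef b n in let bn1 := Ucoef b n.-1 in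
  let cn := Tcoef c n in let cn1 := Tcoef c n.-1 in
  let dn := Ucoef d n in let dn1 := Ucoef d n.-1 in
  let s := an ^+ 2 + cn ^+ 2 in
  if s == 0 then qone
  else if n == 1%N then (Num.sqrt (qM qh)`_0)^-1 *: qconj qh
  else
    let al1 := an in let be1 := - bn in let ga1 := - cn in let de1 := - dn in
    let al0 := an1 / 2 - (bn * bn1 + dn * dn1) / (2 * s) * an
               + (bn * dn1 - dn * bn1) / (2 * s) * cn in
    let ga0 := - (cn1 / 2) + (bn * bn1 + dn * dn1) / (2 * s) * cn
               + (bn * dn1 - dn * bn1) / (2 * s) * an in
    let K := (Num.sqrt (al0 ^+ 2 + ga0 ^+ 2
               + 2^-1 * (al1 ^+ 2 + be1 ^+ 2 + ga1 ^+ 2 + de1 ^+ 2)))^-1 in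
    K *: ((al1 *: chebT 1 + al0%:P, be1 *: chebU 1,
           ga1 *: chebT 1 + ga0%:P, de1 *: chebU 1) : quad R).

(* qM q is constant for q in Q_0. *)
Definition normalize0 (q : quad R) : quad R :=
  if q == 0 then qone else (Num.sqrt (qM q)`_0)^-1 *: q.

Fixpoint quad_proj (n : nat) (q : quad R) : quad R :=
  match n with
  | 0 => normalize0 q
  | m.+1 =>
    let qh := chi m.+1 q in
    let e := phi m.+1 qh in
    qmul (qconj e) (quad_proj m (qmul e qh))
  end.

End Functions.
End Correction.

Arguments A8 R : clear implicits.
Arguments B8 R : clear implicits.
Arguments S8 R : clear implicits.
Arguments A6 R : clear implicits.
Arguments B6 R : clear implicits.
Arguments S6 R : clear implicits.

(* Main.v *)
Require Import Defs.
From mathcomp Require Import all_boot all_order all_algebra ring lra.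
From mathcomp Require Import all_classical all_reals all_analysis.
From mathcomp Require Import measurable_realfun.

Set Implicit Arguments.
Unset Strict Implicit.
Unset Printing Implicit Defensive.

Import Order.TTheory GRing.Theory Num.Theory.
Import numFieldNormedType.Exports.

Local Open Scope classical_set_scope.
Local Open Scope ring_scope.

(** In the variable [x = (cos t + 1) / 2] a quadruplet [(a, b, c, d)] is a
    quaternion-valued trigonometric polynomial: [a] and [c] are sums of cosines,
    [b * sqrt w] and [d * sqrt w] are sums of sines, [qM] is the squared modulus,
    [wnorm] is integration in [t] over half a period ([is_derive_arc],
    [wint_chebT]), and [qnorm] is the resulting L2 norm. The modulus is
    multiplicative ([qM_qmul]), so multiplication by a factor [e] with
    [qM e = 1] is an isometry, undone by its conjugate ([qmul_conjK]).

    Put [defect q = wnorm (qM q - 1)]; this is the distance between [p0] and [p1].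
    The projection peels off one degree at a time, in two moves.

    The correction replaces the vector [X] of top coefficients by
    [Y = M^-1 X], where [M = 1 + l A + m B] minimizes [<X, M^-1 X>].
    Criticality says that the forms [A] and [B] vanish at [Y]
    ([inv_form_critical]). Hence [Y] is orthogonal to [X - Y], and
    [|X - Y|^2 = |X|^2 - <X, M^-1 X>] is at most [l A(X, X) + m B(X, X)]
    ([pencil_min_corrected]). As [l] and [m] are bounded on the domain, and
    [A(X, X)], [B(X, X)] are multiples of the two top Chebyshev coefficients of
    [qM q - 1] ([qM_top]), which are at most a multiple of its norm
    ([topT_le_defect]), the correction moves [q] by at most a constant times
    [sqrt (defect q)] ([chi_correction_step]). It also kills the two top
    coefficients of [qM], which is what makes the second move possible: there is
    then a factor [e] of degree one, with [qM e = 1], such that [qmul e q] has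
    lower degree ([phi_factor_step]).

    Only the first move changes the distance to the final result or the defect.
    Since [qM q - qM r] is the polarization of [qM] at [q - r] and [q + r],
    Cauchy-Schwarz ([wnorm_qB]) bounds the new defect by [L * sqrt (defect q)],
    with [L] depending on [H] alone because the norm does not grow in the steps of
    degree at least two ([chi_step]). After [k] steps the defect is thus [O(e^(2^-k))], with a
    constant that does not depend on [k], as the powers of [L] accumulate with
    exponents [1 + 1/2 + 1/4 + ...]. Adding the [n + 1] displacements gives
    [qnorm (q - proj q) <= (n + 1) C e^(2^-(n + 1))] when [e <= 1]
    ([proj_dist]), and Cauchy-Schwarz turns this into the bound on [p0 - tp]; the
    exponent [2^-(2 n + 1)] gives a larger right-hand side.
    When [e > 1] boundedness of the two norms is enough. *)

(** * The Chebyshev weight and its truncated integrals *)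

Section Weight.
Context {R : realType}.
Implicit Types (p q : {poly R}) (x t s : R) (n : nat).

Notation mu := (@lebesgue_measure R).

Definition cweight x : R := (Num.sqrt (@w R).[x])^-1.

Definition angle t : R := (cos t + 1) / 2.

Lemma hornerw x : (@w R).[x] = x * (1 - x).
Proof. by rewrite /w hornerM hornerD hornerN !hornerE. Qed.

Lemma w_ge0 x : 0 <= x <= 1 -> 0 <= (@w R).[x].
Proof. by move=> /andP[x0 x1]; rewrite hornerw mulr_ge0 // subr_ge0. Qed.

Lemma w_gt0 x : 0 < x < 1 -> 0 < (@w R).[x].
Proof. by move=> /andP[x0 x1]; rewrite hornerw mulr_gt0 // subr_gt0. Qed.

Lemma cweight_ge0 x : 0 <= cweight x.
Proof. by rewrite invr_ge0 sqrtr_ge0. Qed.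

Lemma cweight_out x : ~~ (0 < x < 1) -> cweight x = 0.
Proof.
move=> x01; rewrite /cweight ler0_sqrtr ?invr0 // hornerw.
move: x01; rewrite negb_and -!leNgt => /orP[x0|x1].
  by rewrite mulr_le0_ge0 //; lra.
by rewrite mulr_ge0_le0 //; lra.
Qed.

Lemma continuous_cweight x : 0 < x < 1 -> {for x, continuous cweight}.
Proof.
move=> x01; apply: cvgV; first by rewrite gt_eqF // sqrtr_gt0 w_gt0.
apply: continuous_comp; last exact: sqrt_continuous.
exact: continuous_horner.
Qed.

Lemma measurable_cweight (D : set R) : measurable D -> measurable_fun D cweight.
Proof.
move=> mD; have -> : cweight = cweight \_ `]0, 1[%classic.
  apply/funext => x; rewrite patchE; case: ifPn => // x01.
  by rewrite cweight_out //; move: x01; rewrite notin_setE /= in_itv /=; move/negP.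
apply: (@measurable_funS _ _ _ _ setT) => //.
apply/(measurable_restrictT _ _).1 => //.
apply: open_continuous_measurable_fun; first exact: interval_open.
by move=> x; rewrite inE /= in_itv /=; apply: continuous_cweight.
Qed.

(** In the variable [x = (cos t + 1) / 2] the weight is [- dt], so a primitive
    of [cos (n t)] gives a primitive of [chebT n] against the weight. *)
Lemma is_derive_arc (g : R -> R) n x : 0 < x < 1 ->
  (forall t, is_derive t 1 g (cos (n%:R * t))) ->
  is_derive x 1 (fun y => - g (acos (2 * y - 1))) ((chebT n).[x] * cweight x).
Proof.
move=> x01 dg.
have h : -1 < 2 * x - 1 < 1 by lra.
have d1 : is_derive x (1 : R) (fun y : R => 2 * y - 1) 2.
  suff : is_derive x (1 : R) (2 \*: (@id R) - cst 1) (2 *: (1 : R) - 0).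
    by rewrite subr0 scaler1.
  exact: is_deriveB.
have d2 := is_derive1_acos h.
have d3 := @is_derive1_comp R _ _ x _ _ d2 d1.
have d4 := @is_derive1_comp R _ _ x _ _ (dg _) d3.
apply: is_derive_eq (is_deriveN d4) _.
rewrite /comp -chebT_cos acosK; last by rewrite in_itv /=; lra.
have -> : (2 * x - 1 + 1) / 2 = x by field.
rewrite mulNr mulrN opprK; congr (_ * _).
rewrite /cweight hornerw.
have -> : 1 - (2 * x - 1) ^+ 2 = 2 ^+ 2 * (x * (1 - x)) by ring.
rewrite sqrtrM ?sqr_ge0 // sqrtr_sqr ger0_norm // invfM mulrC mulrA divff ?mul1r //.
Qed.

Lemma angle_itv t : 0 < t < pi -> 0 < angle t < 1.
Proof.
move=> /sin_gt0_pi st; have := cos2Dsin2 t; rewrite /angle => cs.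
by apply/andP; split; nra.
Qed.

Lemma acos_angle t : 0 <= t <= pi -> acos (2 * angle t - 1) = t.
Proof.
move=> tpi; have -> : 2 * angle t - 1 = cos t by rewrite /angle; field.
by rewrite cosK // in_itv.
Qed.

(** The points whose angle is at least [s] away from both ends of the half
    circle: the weight is continuous there, and singular at the ends. *)
Definition subarc s : set R := `[angle (pi - s), angle s]%classic.

Lemma subarc_itv s x : 0 < s < pi -> subarc s x -> 0 < x < 1.
Proof.
move=> /andP[s0 spi]; rewrite /subarc /= in_itv /= => /andP[h1 h2].
have /andP[h3 _] : 0 < angle (pi - s) < 1 by apply: angle_itv; lra.
have /andP[_ h4] : 0 < angle s < 1 by apply: angle_itv; lra.
by rewrite (lt_le_trans h3 h1) (le_lt_trans h2 h4).
Qed.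

Lemma integral_chebT_subarc (g : R -> R) n s : 0 < s < pi / 2 ->
  (forall t, is_derive t 1 g (cos (n%:R * t))) ->
  (\int[mu]_(x in subarc s) ((chebT n).[x] * cweight x)%:E
   = (g (pi - s) - g s)%:E)%E.
Proof.
move=> /andP[s0 spi] dg.
have spi' : 0 < s < pi by lra.
have itv x : angle (pi - s) <= x <= angle s -> 0 < x < 1.
  by move=> h; apply: (@subarc_itv s); rewrite // /subarc /= in_itv.
have ab : angle (pi - s) < angle s.
  rewrite /angle cosB cospi sinpi mul0r addr0.
  have : 0 < cos s by apply: cos_gt0_pihalf; lra.
  by move=> *; lra.
pose F : R -> R := fun y => - g (acos (2 * y - 1)).
have dF x : 0 < x < 1 -> is_derive x 1 F
    ((chebT n).[x] * cweight x) by move=> x01; exact: is_derive_arc.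
have cF x : 0 < x < 1 -> {for x, continuous F}.
  move=> x01; apply: differentiable_continuous; apply/derivable1_diffP.
  by have [] := dF x x01.
rewrite (@continuous_FTC2 _ _ F) //.
- rewrite /F !acos_angle; [|lra|lra].
  by rewrite -EFinB opprK addrC.
- apply/subspace_continuousP => x; rewrite /= in_itv /= => /itv x01.
  apply: cvg_within_filter; apply: cvgM; first exact: continuous_horner.
  exact: continuous_cweight.
- split.
  + move=> x; rewrite in_itv /= => /andP[h1 h2].
    by have [] := dF x (itv x _); rewrite ?ltW.
  + by apply: cvg_at_right_filter; apply: cF; apply: itv; rewrite lexx ltW.
  + by apply: cvg_at_left_filter; apply: cF; apply: itv; rewrite lexx ltW.
- move=> x; rewrite in_itv /= => /andP[h1 h2].
  have x01 : 0 < x < 1 by apply: itv; rewrite !ltW.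
  by have d := dF x x01; rewrite derive1E derive_val.
Qed.
End Weight.

(** * Integration of polynomials against the weight *)

Section WeightIntegral.
Context {R : realType}.
Implicit Types (p q : {poly R}) (x t s : R) (n : nat).

Notation mu := (@lebesgue_measure R).

Lemma subarcP s x : 0 < s < pi / 2 ->
  subarc s x <-> 0 < x < 1 /\ s <= acos (2 * x - 1) <= pi - s.
Proof.
move=> /andP[s0 spi].
have e x' : 0 < x' < 1 -> subarc s x' <-> s <= acos (2 * x' - 1) <= pi - s.
  move=> x01; rewrite /subarc /= in_itv /=.
  have h : -1 <= 2 * x' - 1 <= 1 by lra.
  have t0 := acos_ge0 h; have tpi := acos_lepi h.
  have -> : x' = angle (acos (2 * x' - 1)).
    by rewrite /angle acosK ?in_itv //; field.
  have -> : 2 * angle (acos (2 * x' - 1)) - 1 = 2 * x' - 1.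
    by rewrite /angle acosK ?in_itv //; field.
  have L u v : 0 <= u <= pi -> 0 <= v <= pi -> (angle u <= angle v) = (v <= u).
    move=> hu hv; rewrite /angle ler_pM2r // lerD2r.
    by rewrite !leNgt ltr_cos // in_itv.
  rewrite !L; try lra.
split; last by move=> [/e h /h].
move=> xs; have x01 : 0 < x < 1 by apply: subarc_itv xs; lra.
by split=> //; apply/e.
Qed.

Let sq n : R := n.+2%:R^-1.

Let sq_itv n : 0 < sq n < pi / 2.
Proof.
rewrite invr_gt0 ltr0n /=; apply: (@lt_le_trans _ _ 1).
  by rewrite invf_lt1 ?ltr0n // ltr1n.
by have := pi_ge2 R; lra.
Qed.

Let sq_cvg : sq n @[n --> \oo] --> (0 : R).
Proof.
have -> : sq = fun n => harmonic (n + 1)%N by apply/funext => n; rewrite /sq addn1.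
by rewrite (@cvg_shiftn 1 R (@harmonic R)); apply: cvg_harmonic.
Qed.

Let bigcup_arc : \bigcup_n subarc (sq n) = `]0, 1[%classic.
Proof.
apply/seteqP; split=> x.
  by move=> [n _ /subarcP -/(_ (sq_itv n))[x01 _]]; rewrite /= in_itv.
rewrite /= in_itv /= => x01.
have t0 : 0 < acos (2 * x - 1) by apply: acos_gt0; lra.
have tpi : acos (2 * x - 1) < pi by apply: acos_ltpi; lra.
have m0 : 0 < Num.min (acos (2 * x - 1)) (pi - acos (2 * x - 1)).
  by rewrite lt_min t0 subr_gt0.
have /cvgrPdist_lt /(_ _ m0)[n _ nm] := sq_cvg.
exists n => //; apply/subarcP; first exact: sq_itv.
have := nm n (leqnn n); rewrite sub0r normrN ger0_norm ?invr_ge0 //.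
by rewrite lt_min => /andP[h1 h2]; split=> //; lra.
Qed.

Let nd_arc : nondecreasing_seq (fun n => subarc (sq n)).
Proof.
move=> m n mn; apply/subsetPset => x /subarcP-/(_ (sq_itv m))[x01 h].
apply/subarcP; first exact: sq_itv.
have : sq n <= sq m by rewrite lef_pV2 ?posrE ?ltr0n // ler_nat.
by move=> ?; split=> //; lra.
Qed.

Let marc n : measurable (subarc (sq n)).
Proof. exact: measurable_itv. Qed.

(** Monotone convergence along the exhaustion of the half circle by [subarc]. *)
Lemma integral_cweight : (\int[mu]_(x in `[0%R, 1%R]) (cweight x)%:E = pi%:E)%E.
Proof.
have mf (D : set R) : measurable D -> measurable_fun D (EFin \o cweight).
  by move=> mD; apply/measurable_EFinP; apply: measurable_cweight.
have e : (\int[mu]_(x in `[0%R, 1%R]) (cweight x)%:E =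
          \int[mu]_(x in `]0%R, 1%R[) (cweight x)%:E)%E.
  rewrite [LHS]integral_mkcond [RHS]integral_mkcond; apply: eq_integral => x _.
  rewrite !patchE; case: ifPn => h1; case: ifPn => h2 //.
    rewrite cweight_out //; move: h2; rewrite notin_setE /= in_itv /=.
    by move/negP.
  exfalso; move: h1 h2; rewrite notin_setE inE /= !in_itv /= => h1 h2.
  by apply: h1; lra.
rewrite e -bigcup_arc.
have cv : (\int[mu]_(x in subarc (sq n)) (cweight x)%:E @[n --> \oo] -->
           \int[mu]_(x in \bigcup_n subarc (sq n)) (cweight x)%:E)%E.
  apply: ge0_nondecreasing_set_cvg_integral => // [n|n x _].
    exact: mf.
  by rewrite lee_fin cweight_ge0.
have h n : (\int[mu]_(x in subarc (sq n)) (cweight x)%:E)%E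
           = (pi - sq n - sq n)%:E.
  have dg t : is_derive t 1 (@id R) (cos (0%:R * t)).
    by rewrite mul0r cos0; exact: is_derive_id.
  have /= <- := integral_chebT_subarc (sq_itv n) dg.
  by apply: eq_integral => x _ /=; rewrite hornerC mul1r.
apply: cvg_unique cv _ => //.
rewrite (_ : (fun n => _) = (fun n => (pi - sq n - sq n)%:E)); last first.
  by apply/funext => n; exact: h.
apply: cvg_EFin; first by near=> n.
rewrite -[X in _ --> X]subr0 -[X in _ --> X - _]subr0.
by apply: cvgB => //; apply: cvgB => //; apply: cvg_cst.
Unshelve. all: by end_near. Qed.

Lemma integrable_cweight : mu.-integrable `[0%R, 1%R] (EFin \o (@cweight R)).
Proof.
apply/integrableP; split.
  by apply/measurable_EFinP; apply: measurable_cweight.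
rewrite (_ : integral _ _ _ = pi%:E) ?ltry // -integral_cweight.
by apply: eq_integral => x _ /=; rewrite ger0_norm ?cweight_ge0.
Qed.

Lemma horner_bounded p : exists M, forall x, 0 <= x <= 1 -> `|p.[x]| <= M.
Proof.
exists (\sum_(i < size p) `|p`_i|) => x /andP[x0 x1]; rewrite horner_coef.
apply: (le_trans (ler_norm_sum _ _ _)); apply: ler_sum => i _.
by rewrite normrM normrX (ger0_norm x0) ler_piMr // exprn_ile1.
Qed.

Lemma integrable_poly_cweight p :
  mu.-integrable `[0%R, 1%R] (EFin \o (fun x => p.[x] * cweight x)).
Proof.
have [M pM] := horner_bounded p.
apply: (@le_integrable _ _ _ mu _ _ _ (fun x => M%:E * (cweight x)%:E)%E) => //.
- apply/measurable_EFinP; apply: measurable_funM; first exact: measurable_poly.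
  exact: measurable_cweight.
- move=> x; rewrite /= in_itv /= => x01.
  rewrite lee_fin !normrM; apply: ler_wpM2r => //.
  by rewrite (le_trans (pM _ x01)) // ler_norm.
- by apply: integrableZl => //; apply: integrable_cweight.
Qed.

Definition wint p : R :=
  \int[mu]_(x in `[0%R, 1%R]) (p.[x] * cweight x).

Lemma wintD p q : wint (p + q) = wint p + wint q.
Proof.
rewrite -RintegralD //; try exact: integrable_poly_cweight.
by apply: eq_Rintegral => x _; rewrite hornerD mulrDl.
Qed.

Lemma wintZ k p : wint (k *: p) = k * wint p.
Proof.
rewrite -RintegralZl //; last exact: integrable_poly_cweight.
by apply: eq_Rintegral => x _; rewrite hornerZ mulrA.
Qed.

Lemma wint1 : wint 1 = pi.
Proof.
rewrite /wint /Rintegral -[RHS]/(fine (pi%:E)) -integral_cweight; congr fine.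
by apply: eq_integral => x _; rewrite hornerC mul1r.
Qed.

(** Dominated convergence along [subarc]: the primitive [sin (n t) / n] vanishes
    at both ends of the half circle. *)
Lemma wint_chebT n : (0 < n)%N -> wint (chebT n) = 0.
Proof.
move=> n0; pose f x := (chebT n).[x] * @cweight R x.
have nz : n%:R != 0 :> R by rewrite pnatr_eq0 -lt0n.
pose g t : R := n%:R^-1 * sin (n%:R * t).
have dg t : is_derive t 1 g (cos (n%:R * t)).
  have d1 : is_derive t 1 ( *%R (n%:R : R)) n%:R.
    suff : is_derive t 1 ((n%:R : R) \*: (@id R)) ((n%:R : R) *: (1 : R)).
      by rewrite scaler1.
    exact: is_deriveZ.
  have d2 := @is_derive1_comp R _ _ t _ _ (is_derive_sin _) d1.
  apply: is_derive_eq (is_deriveZ n%:R^-1 d2) _.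
  by rewrite /GRing.scale /= mulrCA mulVf // mulr1.
have int_f := integrable_poly_cweight (chebT n).
have mf : measurable_fun (`[0%R, 1%R]%classic : set R) (EFin \o f).
  by have /integrableP[] := int_f.
have sub k : subarc (sq k) `<=` `[0%R, 1%R]%classic.
  move=> x /subarcP-/(_ (sq_itv k))[/andP[x0 x1] _].
  by rewrite /= in_itv /= !ltW.
have cv : (\int[mu]_(x in `[0%R, 1%R]) ((EFin \o f) \_ (subarc (sq k))) x @[k --> \oo]
    --> \int[mu]_(x in `[0%R, 1%R]) (f x)%:E)%E.
  have [] // := @dominated_convergence _ _ R mu `[0%R, 1%R]%classic
    (measurable_itv _) (fun k => (EFin \o f) \_ (subarc (sq k))) (EFin \o f)
    (fun x => `|(EFin \o f) x|%E).
  - move=> k; apply: (@measurable_funS _ _ _ _ setT) => //.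
    apply/(measurable_restrictT _ _).1 => //; first exact: marc.
    by apply: measurable_funS mf => //; exact: sub.
  - apply: aeW => x _; apply: cvg_near_cst.
    have [x01|x01] := boolP (0 < x < 1); last first.
      near=> k; rewrite patchE; case: ifPn => // _.
      by rewrite /f /= cweight_out ?mulr0.
    have : (\bigcup_n subarc (sq n)) x by rewrite bigcup_arc /= in_itv.
    move=> [N _ Nx]; near=> k; rewrite patchE mem_set //.
    have : (N <= k)%N by near: k; exact: nbhs_infty_ge.
    by move/nd_arc/subsetPset; apply.
  - exact: integrable_abse.
  - apply: aeW => x k _; rewrite patchE; case: ifPn => // _.
    by rewrite abse0 abse_ge0.
have h k : (\int[mu]_(x in `[0%R, 1%R]) ((EFin \o f) \_ (subarc (sq k))) x
           = (g (pi - sq k) - g (sq k))%:E)%E.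
  have <- := integral_chebT_subarc (sq_itv k) dg.
  rewrite -integral_mkcondr; congr (integral _ _ _).
  by apply: setIidr; exact: sub.
have cg : continuous g.
  move=> t; apply: differentiable_continuous; apply/derivable1_diffP.
  by have [] := dg t.
have lim0 : (\int[mu]_(x in `[0%R, 1%R]) ((EFin \o f) \_ (subarc (sq k))) x @[k --> \oo]
    --> (g (pi - 0) - g 0)%:E)%E.
  rewrite (_ : (fun k => _) = (fun k => (g (pi - sq k) - g (sq k))%:E)); last first.
    by apply/funext => k; exact: h.
  apply: cvg_EFin; first by near=> k.
  apply: cvgB; apply: (continuous_cvg _ (cg _)) => //.
  by apply: cvgB => //; apply: cvg_cst.
rewrite /wint /Rintegral (cvg_unique _ cv lim0) //= /g subr0 mulr0 sin0 mulr0 subr0.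
have sinnpi k : sin (k%:R * pi : R) = 0.
  elim: k => [|k IH]; first by rewrite mul0r sin0.
  by rewrite -natr1 mulrDl mul1r sinD IH sinpi mul0r mulr0 addr0.
by rewrite sinnpi mulr0.
Unshelve. all: by end_near. Qed.

End WeightIntegral.

(** * The weighted norm and the norm of quadruplets *)

Section WeightedNorm.
Context {R : realType}.
Implicit Types (p q : {poly R}) (x s : R).

Lemma wintN p : wint (- p) = - wint p.
Proof. by rewrite -scaleN1r wintZ mulN1r. Qed.

Lemma wintB p q : wint (p - q) = wint p - wint q.
Proof. by rewrite wintD wintN. Qed.

Lemma wint_sum (I : Type) (r : seq I) (F : I -> {poly R}) :
  wint (\sum_(i <- r) F i) = \sum_(i <- r) wint (F i).
Proof.
apply: (big_morph wint (@wintD R)).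
by rewrite -(scale0r 0) wintZ mul0r.
Qed.

Lemma integrable_norm_cweight p :
  (@lebesgue_measure R).-integrable `[0%R, 1%R]
    (EFin \o (fun x => `|p.[x]| * cweight x)).
Proof.
apply: le_integrable (integrable_poly_cweight p) => //.
- apply/measurable_EFinP; apply: measurable_funM.
    by apply: measurableT_comp => //; exact: measurable_poly.
  exact: measurable_cweight.
- by move=> x _; rewrite /= !normrM normr_id.
Qed.

Lemma wnorm_le_wint p q :
  (forall x, 0 <= x <= 1 -> `|p.[x]| <= q.[x]) -> wnorm p <= wint q.
Proof.
move=> pq; apply: le_Rintegral => //.
- exact: integrable_norm_cweight.
- exact: integrable_poly_cweight.
- move=> x; rewrite /= in_itv /= => x01; apply: ler_wpM2r; last exact: pq.
  exact: cweight_ge0.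
Qed.

Lemma wint_le_wnorm p : wint p <= wnorm p.
Proof.
apply: le_Rintegral => //.
- exact: integrable_poly_cweight.
- exact: integrable_norm_cweight.
- move=> x _; apply: ler_wpM2r; [exact: cweight_ge0|exact: ler_norm].
Qed.

Lemma wnorm_wint p : (forall x, 0 <= x <= 1 -> 0 <= p.[x]) -> wnorm p = wint p.
Proof.
move=> p0; apply: le_anti; apply/andP; split; last exact: wint_le_wnorm.
by apply: wnorm_le_wint => x /p0 h; rewrite ger0_norm.
Qed.

Lemma wnorm_ge0 p : 0 <= wnorm p.
Proof. by apply: Rintegral_ge0 => x _; rewrite mulr_ge0 // invr_ge0 sqrtr_ge0. Qed.

Lemma wnormM_le p q :
  (forall x, 0 <= x <= 1 -> `|q.[x]| <= 1) -> wnorm (p * q) <= wnorm p.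
Proof.
move=> q1; apply: le_Rintegral => //; try exact: integrable_norm_cweight.
move=> x; rewrite /= in_itv /= => x01; apply: ler_wpM2r; first exact: cweight_ge0.
by rewrite hornerM normrM ler_piMr // q1.
Qed.

Lemma wnormN p : wnorm (- p) = wnorm p.
Proof. by apply: eq_Rintegral => x _; rewrite hornerN normrN. Qed.

Lemma wnormD p q : wnorm (p + q) <= wnorm p + wnorm q.
Proof.
have i := integrable_norm_cweight.
have ipq : (@lebesgue_measure R).-integrable `[0%R, 1%R]
    (EFin \o (fun x => `|p.[x]| * cweight x + `|q.[x]| * cweight x)).
  exact: integrableD (i p) (i q).
rewrite -RintegralD; [|by []|exact: i|exact: i].
apply: le_Rintegral; [by []|exact: i|exact: ipq|move=> x _].
rewrite hornerD -mulrDl; apply: ler_wpM2r; first exact: cweight_ge0.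
exact: ler_normD.
Qed.

Lemma abs_wint_le_wnorm p : `|wint p| <= wnorm p.
Proof.
rewrite ler_norml wint_le_wnorm andbT lerNl -wintN -wnormN.
exact: wint_le_wnorm.
Qed.

Lemma wint_ge0 p : (forall x, 0 <= x <= 1 -> 0 <= p.[x]) -> 0 <= wint p.
Proof. by move=> /wnorm_wint <-; exact: wnorm_ge0. Qed.

Lemma wint_le p q :
  (forall x, 0 <= x <= 1 -> p.[x] <= q.[x]) -> wint p <= wint q.
Proof.
move=> pq; rewrite -subr_ge0 -wintB; apply: wint_ge0 => x /pq.
by rewrite hornerD hornerN subr_ge0.
Qed.

Lemma wintC (c : R) : wint c%:P = c * pi.
Proof. by rewrite -alg_polyC wintZ wint1. Qed.

End WeightedNorm.

Section QuadNorm.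
Context {R : realType}.
Implicit Types (u v q r : quad R) (x s : R).

(** Polarization of [qM]. *)
Definition qB u v : {poly R} :=
  let: (a, b, c, d) := u in let: (a', b', c', d') := v in
  a * a' + b * b' * w + c * c' + d * d' * w.

Lemma qME u : qM u = qB u u.
Proof. by case: u => [[[a b] c] d]; rewrite /qM /qB !expr2. Qed.

Lemma qBDl u v q : qB (u + v) q = qB u q + qB v q.
Proof.
by case: u v q => [[[? ?] ?] ?] [[[? ?] ?] ?] [[[? ?] ?] ?]; rewrite /qB /=; ring.
Qed.

Lemma qBC u v : qB u v = qB v u.
Proof. by case: u v => [[[? ?] ?] ?] [[[? ?] ?] ?]; rewrite /qB /=; ring. Qed.

Lemma qBNl u v : qB (- u) v = - qB u v.
Proof. by case: u v => [[[? ?] ?] ?] [[[? ?] ?] ?]; rewrite /qB /=; ring. Qed.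

Lemma qBZl k u v : qB (k *: u) v = k *: qB u v.
Proof.
case: u v => [[[? ?] ?] ?] [[[? ?] ?] ?]; rewrite /qB /= -!mul_polyC; ring.
Qed.

Lemma qMD u v : qM (u + v) = qM u + qM v + 2 * qB u v.
Proof. by rewrite !qME !qBDl (qBC u) (qBC v) !qBDl (qBC v u); ring. Qed.

Lemma qMN u : qM (- u) = qM u.
Proof. by rewrite !qME qBNl qBC qBNl opprK. Qed.

Lemma qMZ k u : qM (k *: u) = k ^+ 2 *: qM u.
Proof. by rewrite !qME qBZl qBC qBZl scalerA. Qed.

Lemma qM_sub u v : qM u - qM v = qB (u - v) (u + v).
Proof.
by rewrite !qME qBDl qBNl [qB u (u + v)]qBC [qB v (u + v)]qBC !qBDl (qBC v u); ring.
Qed.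

Lemma horner_qB (a b c d a' b' c' d' : {poly R}) x :
  (qB (a, b, c, d) (a', b', c', d')).[x] = a.[x] * a'.[x] +
    b.[x] * b'.[x] * w.[x] + c.[x] * c'.[x] + d.[x] * d'.[x] * w.[x].
Proof. by rewrite /qB; move: w => v; rewrite !(hornerD, hornerM). Qed.

Lemma horner_qM (a b c d : {poly R}) x :
  (qM (a, b, c, d)).[x] =
    a.[x] ^+ 2 + b.[x] ^+ 2 * w.[x] + c.[x] ^+ 2 + d.[x] ^+ 2 * w.[x].
Proof. by rewrite qME horner_qB !expr2. Qed.

Lemma qM_ge0 u x : 0 <= x <= 1 -> 0 <= (qM u).[x].
Proof.
case: u => [[[a b] c] d] /w_ge0 w0.
rewrite horner_qM; move: w0; set z := w.[x] => w0.
by rewrite !addr_ge0 //; first [exact: sqr_ge0 | apply: mulr_ge0 => //; exact: sqr_ge0].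
Qed.

Lemma qnorm_ge0 u : 0 <= qnorm u.
Proof. exact: sqrtr_ge0. Qed.

Lemma wnorm_qM u : wnorm (qM u) = wint (qM u).
Proof. by apply: wnorm_wint => x; exact: qM_ge0. Qed.

Lemma sqr_qnorm u : qnorm u ^+ 2 = wint (qM u).
Proof. by rewrite -wnorm_qM; apply: sqr_sqrtr; exact: wnorm_ge0. Qed.

Lemma le_qnorm u v :
  (forall x, 0 <= x <= 1 -> (qM u).[x] <= (qM v).[x]) -> qnorm u <= qnorm v.
Proof. by move=> uv; rewrite /qnorm !wnorm_qM; apply/ler_wsqrtr/wint_le. Qed.

Lemma qnormE u v : qM u = qM v -> qnorm u = qnorm v.
Proof. by rewrite /qnorm => ->. Qed.

(** The optimal [s] is [b / a]; shifting both terms by [dl] avoids the degenerate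
    cases. *)
Lemma le_mul_of_amgm (z a b : R) : 0 <= a -> 0 <= b ->
  (forall s, 0 < s -> z <= (s * a ^+ 2 + s^-1 * b ^+ 2) / 2) -> z <= a * b.
Proof.
move=> a0 b0 h; apply/ler_addgt0Pr => e e0.
have ab1 : 0 < a + b + 1 by rewrite ltr_wpDl ?addr_ge0.
pose dl := Num.min 1 (e / (a + b + 1)).
have dl0 : 0 < dl by rewrite lt_min ltr01 divr_gt0.
have dl1 : dl <= 1 by rewrite ge_min lexx.
have dle : dl * (a + b + 1) <= e by rewrite -ler_pdivlMr // ge_min lexx orbT.
have ad : 0 < a + dl by rewrite ltr_wpDl.
have bd : 0 < b + dl by rewrite ltr_wpDl.
apply: (@le_trans _ _ ((a + dl) * (b + dl))); last by nra.
apply: (le_trans (h ((b + dl) / (a + dl)) _)); first by rewrite divr_gt0.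
rewrite invf_div.
have h1 : (b + dl) / (a + dl) * a ^+ 2 <= (b + dl) * (a + dl).
  rewrite mulrAC ler_pdivrMr // -mulrA -expr2; apply: ler_wpM2l; first exact: ltW.
  by rewrite lerXn2r ?nnegrE //; lra.
have h2 : (a + dl) / (b + dl) * b ^+ 2 <= (b + dl) * (a + dl).
  rewrite mulrAC ler_pdivrMr // [leRHS]mulrAC -expr2 [leRHS]mulrC.
  apply: ler_wpM2l; first exact: ltW.
  by rewrite lerXn2r ?nnegrE //; lra.
lra.
Qed.

(** Cauchy-Schwarz with the absolute value inside the integral: the pointwise
    bound [2 |B(u, v)| <= s M(u) + M(v) / s] is integrated and [s] optimized. *)
Lemma wnorm_qB u v : wnorm (qB u v) <= qnorm u * qnorm v.
Proof.
apply: le_mul_of_amgm; rewrite ?qnorm_ge0 // => s s0.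
rewrite !sqr_qnorm -!wintZ -wintD mulrC -wintZ.
apply: wnorm_le_wint => x x01.
have w0 := w_ge0 x01.
have sK : s * s^-1 = 1 by rewrite divff // gt_eqF.
have si0 : 0 < s^-1 by rewrite invr_gt0.
have amgm (y z : R) : `|y * z| <= (s * y ^+ 2 + s^-1 * z ^+ 2) / 2.
  have e1 : 0 <= s * (y - s^-1 * z) ^+ 2 by rewrite mulr_ge0 ?sqr_ge0 // ltW.
  have e2 : 0 <= s * (y + s^-1 * z) ^+ 2 by rewrite mulr_ge0 ?sqr_ge0 // ltW.
  have e3 (z' : R) : s * (y + s^-1 * z') ^+ 2
      = s * y ^+ 2 + 2 * (s * s^-1) * (y * z') + (s * s^-1) * s^-1 * z' ^+ 2.
    by ring.
  move: e1 e2; rewrite -mulrN !e3 sK sqrrN => e1 e2.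
  by rewrite ler_norml; apply/andP; split; lra.
case: u v => [[[a b] c] d] [[[a' b'] c'] d'].
rewrite hornerZ hornerD !hornerZ !horner_qM horner_qB.
have A := amgm a.[x] a'.[x]; have B := amgm b.[x] b'.[x].
have C := amgm c.[x] c'.[x]; have D := amgm d.[x] d'.[x].
have Bw := ler_wpM2r w0 B; have Dw := ler_wpM2r w0 D.
rewrite -[X in _ * X](ger0_norm w0) -normrM in Bw.
rewrite -[X in _ * X](ger0_norm w0) -normrM in Dw.
apply: (@le_trans _ _ (`|a.[x] * a'.[x]| + `|b.[x] * b'.[x] * w.[x]| + `|c.[x] * c'.[x]|
  + `|d.[x] * d'.[x] * w.[x]|)).
  by do 3! (apply: (le_trans (ler_normD _ _)); rewrite ?lerD2r //).
lra.
Qed.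

Lemma qnormD u v : qnorm (u + v) <= qnorm u + qnorm v.
Proof.
rewrite -(@ler_pXn2r _ 2) ?nnegrE ?addr_ge0 ?qnorm_ge0 //.
rewrite sqrrD !sqr_qnorm qMD !wintD.
have -> : 2 * qB u v = 2 *: qB u v by rewrite -mul_polyC polyCMn.
rewrite wintZ; have := le_trans (wint_le_wnorm _) (wnorm_qB u v).
by rewrite mulr2n; lra.
Qed.

Lemma qnormN u : qnorm (- u) = qnorm u.
Proof. by apply: qnormE; rewrite qMN. Qed.

End QuadNorm.

(** * Products and orthogonality of Chebyshev polynomials *)

(* Keeps the polynomials [chebT n.+2] folded under [/=]. *)
#[local] Arguments chebT {R} n : simpl never.
#[local] Arguments chebU {R} n : simpl never.

Section ChebyshevProducts.
Context {R : realType}.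
Implicit Types (p q l : {poly R}) (x y : R) (m n k : nat).

Notation T := (@chebT R).
Notation U := (@chebU R).

Lemma hornerw_angle t : (@w R).[(cos t + 1) / 2] * 4 = sin t ^+ 2.
Proof. by rewrite hornerw sin2cos2; field. Qed.

(** Since [T n] is [cos (n t)] and [U n * sqrt w] is [sin (n t)], the identities
    below are the product-to-sum formulas of trigonometry. *)
Lemma chebT_mul m k : 2 * (T (m + k) * T m) = T (m + m + k) + T k.
Proof.
apply: poly_eq_unit_itv => _ /unit_itv_cos[t -> _].
rewrite -[2](polyC_natr _ 2) hornerM hornerC hornerD hornerM !chebT_cos.
have -> : (m + m + k)%:R * t = (m + k)%:R * t + m%:R * t by rewrite !natrD; ring.
have -> : k%:R * t = (m + k)%:R * t - m%:R * t by rewrite !natrD; ring.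
by rewrite !cosD cosN sinN; ring.
Qed.

Lemma chebU_mul m k : 2 * (U (m + k) * U m * w) = T k - T (m + m + k).
Proof.
apply: poly_eq_unit_itv => _ /unit_itv_cos[t -> st].
apply: (@mulIf _ 4); first by rewrite pnatr_eq0.
rewrite -[2](polyC_natr _ 2) hornerM hornerC hornerD hornerN.
rewrite [in LHS]hornerM [(U _ * _).[_]]hornerM !chebT_cos.
rewrite -!mulrA hornerw_angle.
have -> : (m + m + k)%:R * t = (m + k)%:R * t + m%:R * t by rewrite !natrD; ring.
have -> : k%:R * t = (m + k)%:R * t - m%:R * t by rewrite !natrD; ring.
rewrite !cosD cosN sinN.
have e1 := chebU_sin (m + k) t; have e2 := chebU_sin m t.
transitivity (2 * ((U (m + k)).[(cos t + 1) / 2] * sin t)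
                * ((U m).[(cos t + 1) / 2] * sin t)); first by ring.
by rewrite e1 e2; ring.
Qed.

Lemma chebT1_mul_chebT n : 2 * (T 1 * T n.+1) = T n.+2 + T n.
Proof.
rewrite chebTSS; change (T 1) with (2 *: 'X - 1 : {poly R}).
by rewrite -!mul_polyC polyC_natr; ring.
Qed.

Lemma chebT1_mul_chebU n : 2 * (T 1 * U n.+1) = U n.+2 + U n.
Proof.
rewrite chebUSS; change (T 1) with (2 *: 'X - 1 : {poly R}).
by rewrite -!mul_polyC polyC_natr; ring.
Qed.

Lemma chebU1_mul_chebT n : 2 * (U 1 * T n.+1) = U n.+2 - U n.
Proof.
apply: poly_eq_unit_itv => _ /unit_itv_cos[t -> st].
apply: (mulIf st); rewrite -[2](polyC_natr _ 2).
rewrite hornerM hornerM; change (U 1) with (2%:P : {poly R}).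
rewrite !hornerC hornerD hornerN mulrBl !chebU_sin.
rewrite chebT_cos.
have -> : n.+2%:R * t = n.+1%:R * t + t by rewrite -(natr1 n.+1); ring.
have -> : n%:R * t = n.+1%:R * t - t by rewrite -(natr1 n); ring.
by rewrite !sinD cosN sinN; ring.
Qed.

Lemma size_chebT_le n : (size (T n) <= n.+1)%N.
Proof. by rewrite size_chebT. Qed.

Lemma size_chebU_le n : (size (U n) <= n)%N.
Proof. by rewrite size_chebU. Qed.

Lemma chebT_le1 n x : 0 <= x <= 1 -> `|(T n).[x]| <= 1.
Proof.
move=> x01; have -> : x = (cos (acos (2 * x - 1)) + 1) / 2.
  by rewrite acosK; [field|rewrite in_itv /=; lra].
by rewrite chebT_cos cos_max.
Qed.

Lemma chebU_sqr_le1 n x : 0 <= x <= 1 -> (U n).[x] ^+ 2 * (@w R).[x] <= 1.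
Proof.
move=> x01; have -> : x = (cos (acos (2 * x - 1)) + 1) / 2.
  by rewrite acosK; [field|rewrite in_itv /=; lra].
set t := acos _; rewrite -(@ler_pM2r _ 4) // -mulrA hornerw_angle -exprMn chebU_sin.
by have := cos2Dsin2 (n%:R * t); nra.
Qed.

Lemma wint_mul_chebT n l : (size l <= n)%N -> wint (l * T n) = 0.
Proof.
move=> /(basis_ex (@size_chebT R))[u ->]; rewrite mulr_suml wint_sum big1 // => i _.
rewrite -scalerAl wintZ.
have e : 2 * (T n * T i) = T (i + i + (n - i)) + T (n - i).
  by rewrite -chebT_mul subnKC // ltnW.
have : 2 * wint (T i * T n) = 0.
  rewrite -wintZ -mul_polyC polyC_natr [T i * _]mulrC e wintD !wint_chebT ?addr0 //.
    by rewrite subn_gt0.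
  by rewrite addn_gt0 subn_gt0 ltn_ord orbT.
by move/eqP; rewrite mulf_eq0 pnatr_eq0 /= => /eqP ->; rewrite mulr0.
Qed.

Lemma wint_mul_chebU n l : (size l < n)%N -> wint (l * U n * w) = 0.
Proof.
case: n => // n; rewrite ltnS => sl.
have [u ->] := basis_ex (fun i => @size_chebU R i.+1) sl.
rewrite !mulr_suml wint_sum big1 // => i _; rewrite -!scalerAl wintZ.
have e : 2 * (U n.+1 * U i.+1 * w) = T (n - i) - T (i.+1 + i.+1 + (n - i)).
  by rewrite -chebU_mul addSn subnKC // ltnW.
have : 2 * wint (U i.+1 * U n.+1 * w) = 0.
  rewrite -wintZ -mul_polyC polyC_natr [U i.+1 * _]mulrC e wintB.
  by rewrite !wint_chebT ?subrr // subn_gt0.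
by move/eqP; rewrite mulf_eq0 pnatr_eq0 /= => /eqP ->; rewrite mulr0.
Qed.

Lemma wint_sqr_chebT n : (0 < n)%N -> wint (T n * T n) = pi / 2.
Proof.
move=> n0; have : 2 * wint (T n * T n) = pi.
  rewrite -wintZ -mul_polyC polyC_natr; have := chebT_mul n 0; rewrite addn0 => ->.
  by rewrite wintD wint1 wint_chebT ?add0r // !addn_gt0 n0.
by move=> <-; field.
Qed.

Lemma wint_sqr_chebU n : (0 < n)%N -> wint (U n * U n * w) = pi / 2.
Proof.
move=> n0; have : 2 * wint (U n * U n * w) = pi.
  rewrite -wintZ -mul_polyC polyC_natr; have := chebU_mul n 0; rewrite addn0 => ->.
  by rewrite wintB wint1 wint_chebT ?subr0 // !addn_gt0 n0.
by move=> <-; field.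
Qed.

End ChebyshevProducts.

Section TopCoefficients.
Context {R : realType}.
Implicit Types (p q l : {poly R}) (x y : R) (m n k : nat).

Notation T := (@chebT R).
Notation U := (@chebU R).

(** The two top Chebyshev coordinates, expressed by the size of the remainder: in
    this form they pass through sums and products without appeal to uniqueness
    of coordinates. *)
Definition topT n p x y : Prop :=
  (size (p - (x%:P * T n + y%:P * T n.-1))%R <= n.-1)%N.

(** As [U n] has degree [n.-1], sizes are one less than for [topT]. *)
Definition topU n p x y : Prop :=
  (size (p - (x%:P * U n + y%:P * U n.-1))%R <= n.-2)%N.

Lemma size_add_le k p q :
  (size p <= k)%N -> (size q <= k)%N -> (size (p + q)%R <= k)%N.
Proof. by move=> hp hq; rewrite (leq_trans (size_polyD _ _)) // geq_max hp. Qed.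

Lemma size_sub_le k p q :
  (size p <= k)%N -> (size q <= k)%N -> (size (p - q)%R <= k)%N.
Proof. by move=> hp hq; apply: size_add_le; rewrite ?size_polyN. Qed.

Lemma size_mul_le k m n p q :
  (size p <= m)%N -> (size q <= n)%N -> ((m + n).-1 <= k)%N -> (size (p * q)%R <= k)%N.
Proof.
move=> hp hq; apply: leq_trans; apply: (leq_trans (size_polyMleq _ _)).
by rewrite -!subn1 leq_sub2r // leq_add.
Qed.

Lemma size_Cmul_le k x p : (size p <= k)%N -> (size (x%:P * p)%R <= k)%N.
Proof. by rewrite mul_polyC => /(leq_trans (size_scale_leq _ _)). Qed.

Lemma topTD n p q x y x' y' :
  topT n p x y -> topT n q x' y' -> topT n (p + q) (x + x') (y + y').
Proof.
rewrite /topT => hp hq; have := size_add_le hp hq.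
by rewrite !polyCD; congr (size (polyseq _) <= _)%N; ring.
Qed.

Lemma topTN n p x y : topT n p x y -> topT n (- p) (- x) (- y).
Proof.
rewrite /topT -size_polyN !polyCN; congr (size (polyseq _) <= _)%N; ring.
Qed.

Lemma topUD n p q x y x' y' :
  topU n p x y -> topU n q x' y' -> topU n (p + q) (x + x') (y + y').
Proof.
rewrite /topU => hp hq; have := size_add_le hp hq.
by rewrite !polyCD; congr (size (polyseq _) <= _)%N; ring.
Qed.

Lemma topUN n p x y : topU n p x y -> topU n (- p) (- x) (- y).
Proof.
rewrite /topU -size_polyN !polyCN; congr (size (polyseq _) <= _)%N; ring.
Qed.

Lemma topT_eq n p x y x' y' :
  topT n p x y -> x = x' -> y = y' -> topT n p x' y'.
Proof. by move=> h <- <-. Qed.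

Lemma topU_eq n p x y x' y' :
  topU n p x y -> x = x' -> y = y' -> topU n p x' y'.
Proof. by move=> h <- <-. Qed.

Lemma topT_low n p : topT n p 0 0 <-> (size p <= n.-1)%N.
Proof. by rewrite /topT polyC0 !mul0r addr0 subr0. Qed.

Lemma topU_low n p : topU n p 0 0 <-> (size p <= n.-2)%N.
Proof. by rewrite /topU polyC0 !mul0r addr0 subr0. Qed.

(** The condition [1 < n] reflects that [T 1 * T 0 = T 1] lacks the factor one
    half of the generic product [T 1 * T n.-1]. *)
Lemma topT_mul_linear n p x y u v : (1 < n)%N -> topT n p x y ->
  topT n.+1 ((u *: T 1 + v%:P) * p) (u * x / 2) (u * y / 2 + v * x).
Proof.
case: n => [|[|n]] // _; rewrite /topT /= => hp.
set l := p - _ in hp.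
have h2 : (2^-1)%:P * 2 = 1 :> {poly R}.
  by rewrite -(polyC_natr R 2) -polyCM mulVf ?polyC1 // pnatr_eq0.
have e1 := @chebT1_mul_chebT R n.+1; have e2 := @chebT1_mul_chebT R n.
have -> : (u *: T 1 + v%:P) * p - ((u * x / 2)%:P * T n.+3 + (u * y / 2 + v * x)%:P * T n.+2)
  = (u%:P * T 1 + v%:P) * l + (2^-1 * u * x)%:P * T n.+1
    + (2^-1 * u * y)%:P * T n + (v * y)%:P * T n.+1.
  have -> : p = l + (x%:P * T n.+2 + y%:P * T n.+1) by rewrite /l subrK.
  rewrite -mul_polyC !(polyCD, polyCM).
  apply/eqP; rewrite -subr_eq0; apply/eqP.
  transitivity ((2^-1)%:P * (u * x)%:P * (2 * (T 1 * T n.+2) - (T n.+3 + T n.+1))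
     + (2^-1)%:P * (u * y)%:P * (2 * (T 1 * T n.+1) - (T n.+2 + T n))
     + (1 - (2^-1)%:P * 2) * (u%:P * T 1 * (x%:P * T n.+2 + y%:P * T n.+1))).
    rewrite !(polyCD, polyCM); move: (T 1) (T n.+3) (T n.+2) (T n.+1) (T n) => *; ring.
  by rewrite e1 e2 h2 !subrr !mulr0 mul0r !addr0.
have sT1 : (size (u%:P * T 1 + v%:P)%R <= 2)%N.
  apply: size_add_le; first by apply: size_Cmul_le; rewrite size_chebT.
  by rewrite (leq_trans (size_polyC_leq1 _)).
repeat apply: size_add_le; try (apply: size_Cmul_le; rewrite size_chebT //).
exact: size_mul_le sT1 hp _.
Qed.

End TopCoefficients.

Section TopProducts.
Context {R : realType}.
Implicit Types (p q l : {poly R}) (x y u v : R) (m n k : nat).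

Notation T := (@chebT R).
Notation U := (@chebU R).
Notation half := ((2^-1)%:P : {poly R}).

Let halfK : half * 2 = 1.
Proof. by rewrite -(polyC_natr R 2) -polyCM mulVf ?polyC1 // pnatr_eq0. Qed.

Let half_eq (a b : {poly R}) : 2 * a = b -> a = half * b.
Proof. by move=> <-; rewrite mulrA halfK mul1r. Qed.

Lemma topU_mul_linear n p x y u v : (1 < n)%N -> topU n p x y ->
  topU n.+1 ((u *: T 1 + v%:P) * p) (u * x / 2) (u * y / 2 + v * x).
Proof.
case: n => [|[|n]] // _; rewrite /topU /= => hp.
set l := p - _ in hp.
have e1 := half_eq (@chebT1_mul_chebU R n.+1).
have e2 := half_eq (@chebT1_mul_chebU R n).
have -> : (u *: T 1 + v%:P) * p - ((u * x / 2)%:P * U n.+3 + (u * y / 2 + v * x)%:P * U n.+2)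
  = (u%:P * T 1 + v%:P) * l + (2^-1 * u * x)%:P * U n.+1
    + (2^-1 * u * y)%:P * U n + (v * y)%:P * U n.+1.
  have -> : p = l + (x%:P * U n.+2 + y%:P * U n.+1) by rewrite /l subrK.
  rewrite -mul_polyC !(polyCD, polyCM).
  transitivity ((u%:P * T 1 + v%:P) * l + (u%:P * x%:P * (T 1 * U n.+2)
    + u%:P * y%:P * (T 1 * U n.+1) + v%:P * (x%:P * U n.+2 + y%:P * U n.+1)) -
    ((u%:P * x%:P * half) * U n.+3 + (u%:P * y%:P * half + v%:P * x%:P) * U n.+2)); first by ring.
  by rewrite e1 e2; ring.
have sT1 : (size (u%:P * T 1 + v%:P)%R <= 2)%N.
  apply: size_add_le; first by apply: size_Cmul_le; rewrite size_chebT.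
  by rewrite (leq_trans (size_polyC_leq1 _)).
repeat apply: size_add_le; try (apply: size_Cmul_le; rewrite size_chebU //).
exact: size_mul_le sT1 hp _.
Qed.

Lemma topU_mulU1 n p x y u : (1 < n)%N -> topT n p x y ->
  topU n.+1 (u *: U 1 * p) (u * x / 2) (u * y / 2).
Proof.
case: n => [|[|n]] // _; rewrite /topU /topT /= => hp.
set l := p - _ in hp.
have e1 := half_eq (@chebU1_mul_chebT R n.+1).
have e2 := half_eq (@chebU1_mul_chebT R n).
have -> : u *: U 1 * p - ((u * x / 2)%:P * U n.+3 + (u * y / 2)%:P * U n.+2)
  = u%:P * (U 1 * l) - ((2^-1 * u * x)%:P * U n.+1 + (2^-1 * u * y)%:P * U n).
  have -> : p = l + (x%:P * T n.+2 + y%:P * T n.+1) by rewrite /l subrK.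
  rewrite -mul_polyC !(polyCD, polyCM).
  transitivity (u%:P * (U 1 * l) + (u%:P * x%:P * (U 1 * T n.+2)
    + u%:P * y%:P * (U 1 * T n.+1)) -
    ((u%:P * x%:P * half) * U n.+3 + (u%:P * y%:P * half) * U n.+2)); first by ring.
  by rewrite e1 e2; ring.
apply: size_sub_le; last apply: size_add_le;
  try (apply: size_Cmul_le; rewrite size_chebU //).
by apply: size_Cmul_le; apply: size_mul_le hp _; first exact: size_chebU_le.
Qed.

Lemma size_w : (size (@w R) <= 3)%N.
Proof.
rewrite /w; apply: (@size_mul_le _ _ 2 2) => //; first by rewrite size_polyX.
by apply: size_sub_le; rewrite ?size_poly1 ?size_polyX.
Qed.

Lemma topT_mulU1 n p x y u : (1 < n)%N -> topU n p x y ->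
  topT n.+1 (u *: U 1 * p * w) (- (u * x / 2)) (- (u * y / 2)).
Proof.
case: n => [|[|n]] // _; rewrite /topU /topT /= => hp.
set l := p - _ in hp.
have e1 : U n.+2 * U 1 * w = half * (T n.+1 - T n.+3).
  by apply: half_eq; exact: (@chebU_mul R 1 n.+1).
have e2 : U n.+1 * U 1 * w = half * (T n - T n.+2).
  by apply: half_eq; exact: (@chebU_mul R 1 n).
have -> : u *: U 1 * p * w - ((- (u * x / 2))%:P * T n.+3 + (- (u * y / 2))%:P * T n.+2)
  = u%:P * (U 1 * l * w) + (2^-1 * u * x)%:P * T n.+1 + (2^-1 * u * y)%:P * T n.
  have -> : p = l + (x%:P * U n.+2 + y%:P * U n.+1) by rewrite /l subrK.
  rewrite -mul_polyC !(polyCN, polyCD, polyCM).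
  move: (w) e1 e2 => W e1 e2.
  transitivity (u%:P * (U 1 * l * W) + (u%:P * x%:P * (U n.+2 * U 1 * W)
    + u%:P * y%:P * (U n.+1 * U 1 * W)) +
    ((u%:P * x%:P * half) * T n.+3 + (u%:P * y%:P * half) * T n.+2)); first by ring.
  by rewrite e1 e2; ring.
repeat apply: size_add_le; try (apply: size_Cmul_le; rewrite ?size_chebT //).
have h1 : (size (U 1 * l)%R <= n)%N.
  by apply: size_mul_le hp _; first exact: size_chebU_le.
by apply: size_mul_le h1 size_w _; rewrite addnS addn2.
Qed.

Lemma topT_sqr n p x y : (1 < n)%N -> topT n p x y ->
  topT (2 * n) (p ^+ 2) (x ^+ 2 / 2) (x * y).
Proof.
case: n => [|[|n]] // _; rewrite /topT /= => hp.
set l := p - _ in hp.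
have e1 : T n.+2 * T n.+2 = half * (T (2 * n.+2) + 1).
  by apply: half_eq; have := @chebT_mul R n.+2 0; rewrite !addn0 addnn mul2n.
have e2 : 2 * (T n.+2 * T n.+1) = T (2 * n.+2).-1 + T 1.
  have := @chebT_mul R n.+1 1; rewrite addn1 => ->; congr (T _ + _).
  by rewrite mul2n -addnn addn1 !(addSn, addnS).
have -> : p ^+ 2 - ((x ^+ 2 / 2)%:P * T (2 * n.+2) + (x * y)%:P * T (2 * n.+2).-1)
  = (2^-1 * x ^+ 2)%:P + (x * y)%:P * T 1 + (y ^+ 2)%:P * (T n.+1 * T n.+1)
    + l * l + (2 * x)%:P * (l * T n.+2) + (2 * y)%:P * (l * T n.+1).
  have -> : p = l + (x%:P * T n.+2 + y%:P * T n.+1) by rewrite /l subrK.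
  rewrite !expr2 !(polyCD, polyCM).
  rewrite -!(polyC_natr R 2) in e2.
  transitivity (l * l + 2%:P * x%:P * (l * T n.+2) + 2%:P * y%:P * (l * T n.+1)
    + y%:P * y%:P * (T n.+1 * T n.+1) + (x%:P * x%:P * (T n.+2 * T n.+2)
    + x%:P * y%:P * (2%:P * (T n.+2 * T n.+1))) -
    ((x%:P * x%:P * half) * T (2 * n.+2) + x%:P * y%:P * T (2 * n.+2).-1)).
    rewrite !polyC_natr; ring.
  by rewrite e1 e2; ring.
have e3 : (2 * n.+2).-1 = (n + n).+3 by rewrite mul2n -addnn !(addSn, addnS).
rewrite -[X in (_ <= X)%N]/((2 * n.+2).-1) e3.
have hC c : (size (c%:P : {poly R}) <= (n + n).+3)%N.
  by rewrite (leq_trans (size_polyC_leq1 _)).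
have sT k := @size_chebT_le R k.
repeat apply: size_add_le => //; try apply: size_Cmul_le.
- by rewrite size_chebT.
- by apply: (size_mul_le (sT _) (sT _)); rewrite !addnS addSn.
- by apply: (size_mul_le hp hp); rewrite !addnS addSn ltnW.
- by apply: (size_mul_le hp (sT _)); rewrite !addnS addSn.
- by apply: (size_mul_le hp (sT _)); rewrite !addnS addSn ltnW.
Qed.

Lemma topU_sqr n p x y : (1 < n)%N -> topU n p x y ->
  topT (2 * n) (p ^+ 2 * w) (- (x ^+ 2 / 2)) (- (x * y)).
Proof.
case: n => [|[|n]] // _; rewrite /topT /topU /= => hp.
set l := p - _ in hp.
have e1 : U n.+2 * U n.+2 * w = half * (1 - T (2 * n.+2)).
  by apply: half_eq; have := @chebU_mul R n.+2 0; rewrite !addn0 addnn mul2n.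
have e2 : 2 * (U n.+2 * U n.+1 * w) = T 1 - T (2 * n.+2).-1.
  have := @chebU_mul R n.+1 1; rewrite addn1 => ->; congr (_ - T _).
  by rewrite mul2n -addnn addn1 !(addSn, addnS).
have -> : p ^+ 2 * w - ((- (x ^+ 2 / 2))%:P * T (2 * n.+2) + (- (x * y))%:P * T (2 * n.+2).-1)
  = (2^-1 * x ^+ 2)%:P + (x * y)%:P * T 1 + (y ^+ 2)%:P * (U n.+1 * U n.+1 * w)
    + l * l * w + (2 * x)%:P * (l * U n.+2 * w) + (2 * y)%:P * (l * U n.+1 * w).
  have -> : p = l + (x%:P * U n.+2 + y%:P * U n.+1) by rewrite /l subrK.
  move: (w) e1 e2 => W e1 e2.
  rewrite !expr2 !(polyCN, polyCD, polyCM).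
  rewrite -!(polyC_natr R 2) in e2.
  transitivity (l * l * W + 2%:P * x%:P * (l * U n.+2 * W)
    + 2%:P * y%:P * (l * U n.+1 * W) + y%:P * y%:P * (U n.+1 * U n.+1 * W) + (x%:P * x%:P * (U n.+2 * U n.+2 * W)
    + x%:P * y%:P * (2%:P * (U n.+2 * U n.+1 * W))) +
    ((x%:P * x%:P * half) * T (2 * n.+2) + x%:P * y%:P * T (2 * n.+2).-1)).
    rewrite !polyC_natr; ring.
  by rewrite e1 e2; ring.
have e3 : (2 * n.+2).-1 = (n + n).+3 by rewrite mul2n -addnn !(addSn, addnS).
rewrite -[X in (_ <= X)%N]/((2 * n.+2).-1) e3.
have hC c : (size (c%:P : {poly R}) <= (n + n).+3)%N.
  by rewrite (leq_trans (size_polyC_leq1 _)).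
have sU k := @size_chebU_le R k.
have mulw (f : {poly R}) : (size f <= (n + n).+1)%N -> (size (f * w)%R <= (n + n).+3)%N.
  by move=> hf; apply: size_mul_le hf size_w _; rewrite addn3.
repeat apply: size_add_le => //; try apply: size_Cmul_le; try apply: mulw.
- by rewrite size_chebT.
- by apply: (size_mul_le (sU _) (sU _)); rewrite !addnS addSn.
- by apply: (size_mul_le hp hp); rewrite (leq_trans (leq_pred _)).
- by apply: (size_mul_le hp (sU _)); rewrite !addnS.
- by apply: (size_mul_le hp (sU _)); rewrite !addnS ltnW.
Qed.

End TopProducts.

Section TopPairing.
Context {R : realType}.
Implicit Types (p q l : {poly R}) (x y u v : R) (m n k : nat).

Notation T := (@chebT R).
Notation U := (@chebU R).

(** The cross coordinate is twice the generic one of [topT_sqr]: for [n = 1] the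
    two terms of [T (2 * n).-1 + T 1] coincide. *)
Lemma topT1_sqr p x y : topT 1 p x y -> topT 2 (p ^+ 2) (x ^+ 2 / 2) (2 * x * y).
Proof.
rewrite /topT /= => /size_poly_leq0P/eqP; rewrite subr_eq0 => /eqP ->.
have e1 : 2 * (T 1 * T 1) = T 2 + 1 := @chebT_mul R 1 0.
have -> : (x%:P * T 1 + y%:P * T 0) ^+ 2 - ((x ^+ 2 / 2)%:P * T 2 + (2 * x * y)%:P * T 1)
  = (x ^+ 2 / 2 + y ^+ 2)%:P.
  have -> : T 0 = 1 by [].
  have -> : T 2 = 2 * (T 1 * T 1) - 1 by rewrite e1 addrK.
  have -> : (x ^+ 2 / 2)%:P = (2^-1)%:P * x%:P ^+ 2 :> {poly R}.
    by rewrite mulrC polyCM expr2 polyCM.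
  have h2 : (2^-1)%:P * 2 = 1 :> {poly R}.
    by rewrite -(polyC_natr R 2) -polyCM mulVf ?polyC1 // pnatr_eq0.
  rewrite polyCD !expr2 !polyCM polyC_natr.
  transitivity ((1 - (2^-1)%:P * 2) * (x%:P * x%:P * (T 1 * T 1))
    + (2^-1)%:P * (x%:P * x%:P) + y%:P * y%:P); first by ring.
  by rewrite h2; ring.
exact: size_polyC_leq1.
Qed.

Lemma topU1_sqr p x y : topU 1 p x y -> topT 2 (p ^+ 2 * w) (- (x ^+ 2 / 2)) 0.
Proof.
rewrite /topT /topU /= => /size_poly_leq0P/eqP; rewrite subr_eq0 => /eqP ->.
have e1 : 2 * (U 1 * U 1 * w) = 1 - T 2 := @chebU_mul R 1 0.
have -> : (x%:P * U 1 + y%:P * U 0) ^+ 2 * w - ((- (x ^+ 2 / 2))%:P * T 2 + 0%:P * T 1)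
  = (x ^+ 2 / 2)%:P.
  have -> : U 0 = 0 by [].
  have -> : T 2 = 1 - 2 * (U 1 * U 1 * w) by rewrite e1; ring.
  have -> : (- (x ^+ 2 / 2))%:P = - ((2^-1)%:P * x%:P ^+ 2) :> {poly R}.
    by rewrite mulrC polyCN polyCM expr2 polyCM.
  have -> : (x ^+ 2 / 2)%:P = (2^-1)%:P * x%:P ^+ 2 :> {poly R}.
    by rewrite mulrC polyCM expr2 polyCM.
  have h2 : (2^-1)%:P * 2 = 1 :> {poly R}.
    by rewrite -(polyC_natr R 2) -polyCM mulVf ?polyC1 // pnatr_eq0.
  rewrite polyC0.
  move: (w) => W.
  transitivity ((1 - (2^-1)%:P * 2) * (x%:P ^+ 2 * (U 1 * U 1 * W))
    + (2^-1)%:P * x%:P ^+ 2); first by ring.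
  by rewrite h2; ring.
exact: size_polyC_leq1.
Qed.

Lemma topT_Tcoef n p : (0 < n)%N -> (size p <= n.+1)%N ->
  topT n p (Tcoef p n) (Tcoef p n.-1).
Proof.
case: n => // n _ sp; rewrite /topT /=.
have E : p = \sum_(0 <= i < n.+2) (Tcoef p i)%:P * T i.
  by rewrite {1}(Tcoef_sum sp); apply: eq_bigr => i _; rewrite mul_polyC.
rewrite {1}E big_nat_recr //= big_nat_recr //=.
set A := \sum_(_ <= i < _) _.
rewrite [X in size (polyseq X)](_ : _ = A); last by ring.
apply: (leq_trans (size_sum _ _ _)); apply/bigmax_leqP_seq => i.
rewrite mem_index_iota => /andP[_ ilt] _.
by apply: size_Cmul_le; rewrite size_chebT.
Qed.

(** For [n = 1] the index [n.-1] designates no coordinate: by the shift in its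
    definition, [Ucoef p 0] is [Ucoef p 1]. This is why [y] is quantified. *)
Lemma topU_Ucoef n p : (0 < n)%N -> (size p <= n)%N ->
  exists y, topU n p (Ucoef p n) y /\ ((1 < n)%N -> y = Ucoef p n.-1).
Proof.
case: n => [|[|n]] // _ sp; rewrite /topU /=.
  exists 0; split=> //; rewrite {1}(Ucoef_sum sp) big_nat1 mul_polyC polyC0 mul0r addr0.
  by rewrite subrr size_poly0.
exists (Ucoef p n.+1); split=> //.
have E : p = \sum_(1 <= i < n.+3) (Ucoef p i)%:P * U i.
  by rewrite {1}(Ucoef_sum sp); apply: eq_bigr => i _; rewrite mul_polyC.
rewrite {1}E big_nat_recr //= big_nat_recr //=.
set A := \sum_(_ <= i < _) _.
rewrite [X in size (polyseq X)](_ : _ = A); last by ring.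
apply: (leq_trans (size_sum _ _ _)); apply/bigmax_leqP_seq => i.
rewrite mem_index_iota => /andP[_ ilt] _.
by apply: size_Cmul_le; rewrite size_chebU.
Qed.

Lemma size_topT n p x y : (0 < n)%N -> topT n p x y -> (size p <= n.+1)%N.
Proof.
rewrite /topT => n0 h; rewrite -(subrK (x%:P * T n + y%:P * T n.-1) p).
apply: size_add_le; first by rewrite (leq_trans h) // (leq_trans (leq_pred _)).
apply: size_add_le; apply: size_Cmul_le; rewrite size_chebT //.
by rewrite prednK.
Qed.

Lemma size_topU n p x y : topU n p x y -> (size p <= n)%N.
Proof.
rewrite /topU => h; rewrite -(subrK (x%:P * U n + y%:P * U n.-1) p).
apply: size_add_le; first by rewrite (leq_trans h) // !(leq_trans (leq_pred _)).
by apply: size_add_le; apply: size_Cmul_le; rewrite size_chebU // leq_pred.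
Qed.

Lemma wint_topT n p x y : (1 < n)%N -> topT n p x y ->
  wint (p * T n) = x * (pi / 2) /\ wint (p * T n.-1) = y * (pi / 2).
Proof.
move=> n1 h; have [l sl0 -> {p h}] :
    exists2 l : {poly R}, (size l <= n.-1)%N & p = l + (x%:P * T n + y%:P * T n.-1).
  by exists (p - (x%:P * T n + y%:P * T n.-1)); rewrite ?subrK.
have n0 : (0 < n)%N by apply: ltnW.
have z1 : wint (l * T n) = 0 by rewrite wint_mul_chebT // (leq_trans sl0) // leq_pred.
have z2 : wint (l * T n.-1) = 0 by rewrite wint_mul_chebT.
have z3 : wint (T n.-1 * T n) = 0 by rewrite wint_mul_chebT // size_chebT prednK.
have z4 : wint (T n * T n.-1) = 0 by rewrite [T n * _]mulrC.
have n10 : (0 < n.-1)%N by rewrite -subn1 subn_gt0.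
have e1 := wint_sqr_chebT n0; have e2 := wint_sqr_chebT n10; split.
  transitivity (wint (l * T n + x *: (T n * T n) + y *: (T n.-1 * T n))).
    by congr wint; rewrite -!mul_polyC; ring.
  by rewrite !wintD !wintZ z1 e1 z3 mulr0 add0r addr0.
transitivity (wint (l * T n.-1 + x *: (T n * T n.-1) + y *: (T n.-1 * T n.-1))).
  by congr wint; rewrite -!mul_polyC; ring.
by rewrite !wintD !wintZ z2 e2 z4 mulr0 !add0r.
Qed.

Lemma wint_topU n p x y : (1 < n)%N -> topU n p x y ->
  wint (p * U n * w) = x * (pi / 2) /\ wint (p * U n.-1 * w) = y * (pi / 2).
Proof.
move=> n1 h; have [l sl0 -> {p h}] :
    exists2 l : {poly R}, (size l <= n.-2)%N & p = l + (x%:P * U n + y%:P * U n.-1).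
  by exists (p - (x%:P * U n + y%:P * U n.-1)); rewrite ?subrK.
have n0 : (0 < n)%N by apply: ltnW.
have sl k : (n.-1 <= k)%N -> (size l < k)%N.
  by apply: leq_trans; rewrite (leq_ltn_trans sl0) // ltn_predL -ltnS prednK.
have z1 : wint (l * U n * w) = 0 by apply/wint_mul_chebU/sl/leq_pred.
have z2 : wint (l * U n.-1 * w) = 0 by apply/wint_mul_chebU/sl.
have z3 : wint (U n.-1 * U n * w) = 0.
  by apply: wint_mul_chebU; rewrite size_chebU prednK.
have z4 : wint (U n * U n.-1 * w) = 0 by rewrite [U n * _]mulrC.
have n10 : (0 < n.-1)%N by rewrite -subn1 subn_gt0.
have e1 := wint_sqr_chebU n0; have e2 := wint_sqr_chebU n10.
split.
  transitivity (wint (l * U n * w + x *: (U n * U n * w) + y *: (U n.-1 * U n * w))).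
    by congr wint; rewrite -!mul_polyC; ring.
  by rewrite !wintD !wintZ z1 e1 z3 mulr0 add0r addr0.
transitivity (wint (l * U n.-1 * w + x *: (U n * U n.-1 * w) + y *: (U n.-1 * U n.-1 * w))).
  by congr wint; rewrite -!mul_polyC; ring.
by rewrite !wintD !wintZ z2 e2 z4 mulr0 !add0r.
Qed.

(** The coordinates are integrals against [T n] and [T n.-1], which are bounded
    by 1 and orthogonal to the constant 1. *)
Lemma topT_le_defect n p x y : (1 < n)%N -> topT n p x y ->
  `|x| * (pi / 2) <= wnorm (p - 1) /\ `|y| * (pi / 2) <= wnorm (p - 1).
Proof.
move=> n1 h; have [hx hy] := wint_topT n1 h.
have pi2 : 0 <= pi / 2 :> R by rewrite divr_ge0 ?pi_ge0.
have n10 : (0 < n.-1)%N by rewrite -subn1 subn_gt0.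
have nM (z : R) : `|z| * (pi / 2) = `|z * (pi / 2)| by rewrite normrM (ger0_norm pi2).
rewrite !nM -hx -hy.
have b m : (0 < m)%N -> `|wint (p * T m)| <= wnorm (p - 1).
  move=> m0; have -> : wint (p * T m) = wint ((p - 1) * T m).
    by rewrite mulrBl mul1r wintB wint_chebT ?subr0.
  apply: le_trans (abs_wint_le_wnorm _) _; apply: wnormM_le => z z01.
  exact: chebT_le1.
by split; apply: b => //; apply: ltnW.
Qed.

Lemma topT_coef n p x y : (0 < n)%N -> topT n p x y ->
  x = Tcoef p n /\ y = Tcoef p n.-1.
Proof.
move=> n0 h; have := topTD h (topTN (topT_Tcoef n0 (size_topT n0 h))).
set u := x - _; set v := y - _; rewrite subrr /topT sub0r size_polyN => s.
have u0 : u = 0.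
  apply/eqP; apply/negPn/negP => u0.
  have : (size (u%:P * T n + v%:P * T n.-1)%R = n.+1)%N.
    have su : (size (u%:P * T n)%R = n.+1)%N by rewrite mul_polyC size_scale // size_chebT.
    rewrite size_polyDl su // ltnS; apply: size_Cmul_le.
    by rewrite size_chebT prednK.
  by move=> e; move: s; rewrite e leqNgt ltnS (leq_trans (leq_pred _)).
have v0 : v = 0.
  apply/eqP; apply/negPn/negP => v0.
  by move: s; rewrite u0 polyC0 mul0r add0r mul_polyC size_scale // size_chebT ltnn.
by split; apply/eqP; rewrite -subr_eq0; apply/eqP.
Qed.

End TopPairing.

Section QuadTop.
Context {R : realType}.
Implicit Types (q r : quad R) (n : nat).

Definition qtop n q (a1 a0 b1 b0 c1 c0 d1 d0 : R) : Prop :=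
  let: (a, b, c, d) := q in
  [/\ topT n a a1 a0, topU n b b1 b0, topT n c c1 c0 & topU n d d1 d0].

Lemma qM_top n q a1 a0 b1 b0 c1 c0 d1 d0 : (1 < n)%N ->
  qtop n q a1 a0 b1 b0 c1 c0 d1 d0 ->
  topT (2 * n) (qM q) ((a1 ^+ 2 - b1 ^+ 2 + c1 ^+ 2 - d1 ^+ 2) / 2)
    (a1 * a0 - b1 * b0 + c1 * c0 - d1 * d0).
Proof.
case: q => [[[a b] c] d] n1 [ha hb hc hd].
have := topTD (topTD (topTD (topT_sqr n1 ha) (topU_sqr n1 hb)) (topT_sqr n1 hc))
  (topU_sqr n1 hd).
by congr topT; field.
Qed.

Lemma qM_top1 q a1 a0 b1 b0 c1 c0 d1 d0 :
  qtop 1 q a1 a0 b1 b0 c1 c0 d1 d0 ->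
  topT 2 (qM q) ((a1 ^+ 2 - b1 ^+ 2 + c1 ^+ 2 - d1 ^+ 2) / 2)
    (2 * (a1 * a0 + c1 * c0)).
Proof.
case: q => [[[a b] c] d] [ha hb hc hd].
have := topTD (topTD (topTD (topT1_sqr ha) (topU1_sqr hb)) (topT1_sqr hc))
  (topU1_sqr hd).
by congr topT; field.
Qed.

End QuadTop.

(** * Quadratic forms and the corrected vector *)

Section BilinearForms.
Context {R : realType} {m : nat}.
Implicit Types (M N : 'M[R]_m) (u v x y z : 'cV[R]_m) (t k : R).

Definition bform N u v : R := (u^T *m N *m v) 0 0.
Definition dot u v : R := (u^T *m v) 0 0.

Lemma bformE N u v : bform N u v = dot u (N *m v).
Proof. by rewrite /bform /dot mulmxA. Qed.

Lemma dotE u v : dot u v = \sum_i u i 0 * v i 0.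
Proof. by rewrite /dot mxE; apply: eq_bigr => i _; rewrite mxE. Qed.

Lemma bform_sumE N u v : bform N u v = \sum_i \sum_j u i 0 * (N i j * v j 0).
Proof.
by rewrite bformE dotE; apply: eq_bigr => i _; rewrite mxE mulr_sumr.
Qed.

Lemma dotC u v : dot u v = dot v u.
Proof. by rewrite !dotE; apply: eq_bigr => i _; rewrite mulrC. Qed.

Lemma dotDl x y z : dot (x + y) z = dot x z + dot y z.
Proof. by rewrite /dot linearD mulmxDl mxE. Qed.

Lemma dotZl k x z : dot (k *: x) z = k * dot x z.
Proof. by rewrite /dot linearZ -scalemxAl mxE. Qed.

Lemma dotDr x y z : dot z (x + y) = dot z x + dot z y.
Proof. by rewrite dotC dotDl !(dotC z). Qed.

Lemma dotZr k x z : dot z (k *: x) = k * dot z x.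
Proof. by rewrite dotC dotZl (dotC z). Qed.

Lemma dotNr x z : dot z (- x) = - dot z x.
Proof. by rewrite -scaleN1r dotZr mulN1r. Qed.

Lemma dotBr x y z : dot z (x - y) = dot z x - dot z y.
Proof. by rewrite dotDr dotNr. Qed.

Lemma dotBl x y z : dot (x - y) z = dot x z - dot y z.
Proof. by rewrite dotC dotBr !(dotC z). Qed.

Lemma dot_ge0 u : 0 <= dot u u.
Proof. by rewrite dotE sumr_ge0 // => i _; rewrite -expr2 sqr_ge0. Qed.

Lemma bform1 u v : bform 1%:M u v = dot u v.
Proof. by rewrite bformE mul1mx. Qed.

Lemma bformD M N u v : bform (M + N) u v = bform M u v + bform N u v.
Proof. by rewrite !bformE mulmxDl dotDr. Qed.

Lemma bformZ k N u v : bform (k *: N) u v = k * bform N u v.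
Proof. by rewrite !bformE -scalemxAl dotZr. Qed.

Lemma bform_sym N u v : N^T = N -> bform N u v = bform N v u.
Proof.
move=> sN; rewrite /bform -[in LHS](trmxK (u^T *m N *m v)) mxE.
by rewrite !trmx_mul sN trmxK mulmxA.
Qed.

Lemma bform_bound N :
  exists2 K, 0 <= K & forall v, `|bform N v v| <= K * dot v v.
Proof.
exists (\sum_i \sum_j `|N i j|); first by do 2! apply: sumr_ge0 => ? _.
move=> v; rewrite bform_sumE mulr_suml.
apply: (le_trans (ler_norm_sum _ _ _)); apply: ler_sum => i _.
rewrite mulr_suml; apply: (le_trans (ler_norm_sum _ _ _)); apply: ler_sum => j _.
have sq l : v l 0 ^+ 2 <= dot v v.
  rewrite dotE (bigD1 l) //= -expr2 lerDl sumr_ge0 // => k _.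
  by rewrite -expr2 sqr_ge0.
rewrite mulrCA normrM; apply: ler_wpM2l => //.
have := sq i; have := sq j; have h := sqr_ge0 (v i 0 - v j 0).
have h' := sqr_ge0 (v i 0 + v j 0).
by rewrite ler_norml; move=> *; apply/andP; split; nra.
Qed.

Lemma posdef_unit N : posdef N -> N \in unitmx.
Proof.
move=> pN; rewrite -row_free_unit; apply: inj_row_free => v vN.
apply/eqP; apply/negPn/negP => v0.
have := pN v^T; rewrite trmx_eq0 v0 trmxK vN mul0mx mxE ltxx.
by move=> /(_ isT).
Qed.

Lemma posdef_ge0 N v : posdef N -> 0 <= bform N v v.
Proof.
move=> pN; have [->|/pN/ltW //] := eqVneq v 0.
by rewrite /bform mulmx0 mxE.
Qed.

Lemma posdef_CauchySchwarz N u v : N^T = N -> posdef N ->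
  bform N u v ^+ 2 <= bform N u u * bform N v v.
Proof.
move=> sN pN; have [->|v0] := eqVneq v 0.
  by rewrite [X in X ^+ 2]/bform [X in _ * X]/bform !mulmx0 mxE mulr0 expr0n.
have qv : 0 < bform N v v := pN v v0.
have := posdef_ge0 (bform N v v *: u - bform N u v *: v) pN.
rewrite bformE mulmxBr -!scalemxAr dotBr !dotZr !dotBl !dotZl -!bformE.
rewrite (bform_sym v u sN) => h.
rewrite -subr_ge0 -(pmulr_rge0 _ qv); move: h; congr (0 <= _); ring.
Qed.

(** Cauchy-Schwarz for [N] between [v] and [invmx N *m v], the form of [invmx N]
    being bounded. *)
Lemma posdef_coercive N : N^T = N -> posdef N ->
  exists2 K, 0 <= K & forall v, dot v v <= K * bform N v v.
Proof.
move=> sN pN; have uN := posdef_unit pN.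
have [K K0 hK] := bform_bound (invmx N); exists K => // v.
have [->|v0] := eqVneq v 0.
  by rewrite /dot /bform !mulmx0 mxE mulr0.
have qv : 0 < bform N v v := pN v v0.
have h := posdef_CauchySchwarz v (invmx N *m v) sN pN.
have e1 : bform N v (invmx N *m v) = dot v v by rewrite bformE mulKVmx.
have e2 : bform N (invmx N *m v) (invmx N *m v) = bform (invmx N) v v.
  by rewrite bformE mulKVmx // dotC -bformE.
rewrite e1 e2 in h.
have h2 : bform (invmx N) v v <= K * dot v v by rewrite (le_trans (ler_norm _)).
have dv : 0 < dot v v.
  rewrite lt_neqAle dot_ge0 andbT eq_sym; apply/negP => /eqP d0.
  move/eqP: v0; apply; apply/matrixP => i j; rewrite ord1 mxE.
  move/eqP: d0; rewrite dotE psumr_eq0; last by move=> *; rewrite -expr2 sqr_ge0.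
  by move=> /allP/(_ i (mem_index_enum _)); rewrite /= -expr2 sqrf_eq0 => /eqP.
rewrite -(ler_pM2r dv) -expr2 (le_trans h) //.
by rewrite [leRHS]mulrAC [leRHS]mulrC ler_pM2l.
Qed.

Lemma invmx_sym N : N^T = N -> (invmx N)^T = invmx N.
Proof. by move=> sN; rewrite trmx_inv sN. Qed.

(** Dual description of the inverse form: the supremum is attained at
    [y = N^-1 x]. *)
Lemma posdef_inv_ge N x y : N^T = N -> posdef N ->
  2 * dot y x - bform N y y <= bform (invmx N) x x.
Proof.
move=> sN pN; have uN := posdef_unit pN.
have := posdef_ge0 (invmx N *m x - y) pN.
rewrite bformE mulmxBr mulKVmx // dotBr !dotBl -!bformE.
rewrite (bform_sym _ y sN) [bform N y _]bformE mulKVmx // (dotC _ x) -bformE.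
by move=> ?; lra.
Qed.

(** Coercivity of [M] makes the form of [M + t *: N] at least half of that of [M]
    for small [t]; [posdef_inv_ge] then compares the inverses. *)
Lemma posdef_perturb M N : M^T = M -> N^T = N -> posdef M ->
  exists2 dl, 0 < dl & forall t, `|t| <= dl ->
    posdef (M + t *: N) /\
    forall z, bform (invmx (M + t *: N)) z z <= 2 * bform (invmx M) z z.
Proof.
move=> sM sN pM.
have [K K0 hK] := posdef_coercive sM pM; have [L L0 hL] := bform_bound N.
have KL : 0 <= L * K by rewrite mulr_ge0.
exists (2 * (L * K + 1))^-1; first by rewrite invr_gt0; lra.
move=> t ht.
have half v : bform M v v <= 2 * bform (M + t *: N) v v.
  have qv := posdef_ge0 v pM.
  have h1 : `|t * bform N v v| <= 2^-1 * bform M v v.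
    rewrite normrM.
    have h2 : `|bform N v v| <= L * K * bform M v v.
      by rewrite (le_trans (hL v)) // -mulrA ler_wpM2l.
    have h3 : `|t| * (L * K) <= 2^-1.
      apply: (@le_trans _ _ (`|t| * (L * K + 1))); first by rewrite ler_wpM2l // lerDl.
      rewrite -ler_pdivlMr; last by lra.
      by rewrite (le_trans ht) // invfM.
    apply: (le_trans (ler_wpM2l (normr_ge0 t) h2)).
    by rewrite mulrA ler_wpM2r.
  by rewrite bformD bformZ; move: h1; rewrite ler_norml => /andP[h _]; lra.
have sP : (M + t *: N)^T = M + t *: N by rewrite linearD linearZ /= sM sN.
have pP : posdef (M + t *: N).
  move=> v v0; have := half v; have := pM v v0.
  by rewrite -![(_^T *m _ *m _) 0 0]/(bform _ _ _) => *; lra.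
split=> // z; have uP := posdef_unit pP.
pose u := invmx (M + t *: N) *m z.
have e1 : dot u z = bform (invmx (M + t *: N)) z z by rewrite bformE dotC.
have e2 : bform (M + t *: N) u u = bform (invmx (M + t *: N)) z z.
  by rewrite bformE mulKVmx.
have := posdef_inv_ge z (2^-1 *: u) sM pM; have := half u.
rewrite e2 (bformE M (_ *: _)) -scalemxAr dotZr !dotZl -bformE e1 => h1 h2.
lra.
Qed.

(** With [y = M^-1 x], the value at [x] of the inverse form changes by
    [- t N(y, y) + O(t^2)], and both signs of [t] are allowed. *)
Lemma inv_form_critical M N x : M^T = M -> N^T = N -> posdef M ->
  (forall t, posdef (M + t *: N) ->
     bform (invmx M) x x <= bform (invmx (M + t *: N)) x x) ->
  bform N (invmx M *m x) (invmx M *m x) = 0.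
Proof.
move=> sM sN pM min; set y := invmx M *m x; set a := bform N y y.
have [dl dl0 hd] := posdef_perturb sM sN pM; have uM := posdef_unit pM.
pose c := 2 * bform (invmx M) (N *m y) (N *m y).
have c0 : 0 <= c.
  rewrite mulr_ge0 // -[N *m y](mulKVmx uM) bformE mulKmx // dotC -bformE.
  exact: posdef_ge0.
have key t : `|t| <= dl -> t * a <= t ^+ 2 * c.
  move=> /hd[pP hP]; have := min t pP.
  have uP := posdef_unit pP; set P := M + t *: N in pP hP uP *.
  have sP : P^T = P by rewrite /P linearD linearZ /= sM sN.
  pose s := invmx P *m (N *m y).
  have e1 : invmx P *m x = y - t *: s.
    rewrite -[RHS](mulKmx uP) mulmxBr -scalemxAr /s mulKVmx // mulmxDl.
    by rewrite -scalemxAl addrK mulKVmx.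
  have e2 : dot x s = a - t * bform (invmx P) (N *m y) (N *m y).
    rewrite -bformE (bform_sym _ _ (invmx_sym sP)) bformE e1 dotBr dotZr.
    by rewrite (dotC _ y) -!bformE.
  rewrite [bform (invmx P) x x]bformE e1 dotBr dotZr e2 bformE => h.
  have := ler_wpM2l (sqr_ge0 t) (hP (N *m y)).
  rewrite -/c; lra.
apply/eqP; apply/negPn/negP => a0.
pose t := Num.min dl (`|a| / (c + 1)) * Num.sg a.
have na : 0 < `|a| by rewrite normr_gt0.
have c1 : 0 < c + 1 by lra.
pose r := Num.min dl (`|a| / (c + 1)).
have r0 : 0 < r by rewrite lt_min dl0 divr_gt0.
have rdl : r <= dl by rewrite ge_min lexx.
have ra : r * (c + 1) <= `|a| by rewrite -ler_pdivlMr // ge_min lexx orbT.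
have tn : `|t| = r by rewrite normrM normr_sg a0 mulr1 gtr0_norm.
have := key t; rewrite tn => /(_ rdl).
have -> : t * a = r * `|a| by rewrite /t -mulrA -normrEsg.
have -> : t ^+ 2 = r ^+ 2 by rewrite -[t ^+ 2]real_normK ?num_real // tn.
by rewrite expr2 -mulrA ler_pM2l //; lra.
Qed.

End BilinearForms.

Section CorrectedVectors.
Context {R : realType} {m : nat}.
Variables (A B : 'M[R]_m).
Implicit Types (X Y Z : 'cV[R]_m).

(** The conditions are closed, so that they survive the limits by which a
    correction is defined at exceptional vectors. *)
Definition corrected X Y : Prop :=
  [/\ bform A Y Y = 0, bform B Y Y = 0, dot Y (X - Y) = 0
    & dot (X - Y) (X - Y) <= `|bform A X X| + 2 * `|bform B X X|].

Hypotheses (sA : A^T = A) (sB : B^T = B).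
Hypothesis dom_bounded :
  forall lm, pencil_dom A B lm -> `|lm.1| <= 1 /\ `|lm.2| <= 2.

(** From [X = M Y] and the vanishing of both forms at [Y] it follows that
    [<Y, X - Y> = 0], whence [|X - Y|^2 = |X|^2 - <X, M^-1 X>]; the inequality
    [posdef_inv_ge] at [y = X] bounds this by [l A(X, X) + m B(X, X)]. *)
Lemma pencil_min_corrected X lm : pencil_min A B X lm ->
  corrected X (invmx (pencil A B lm) *m X).
Proof.
move=> [dlm min]; set M := pencil A B lm.
have pM : posdef M by [].
have uM := posdef_unit pM.
have sM : M^T = M.
  by rewrite /M /pencil !linearD !linearZ /= tr_scalar_mx sA sB.
set Y := invmx M *m X.
have hA : bform A Y Y = 0.
  apply: inv_form_critical => // t pt.
  have e : M + t *: A = pencil A B (lm.1 + t, lm.2).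
    by rewrite /M /pencil /= scalerDl -!addrA; congr (_ + (_ + _)); rewrite addrC.
  by rewrite e; apply: min; rewrite /pencil_dom /= -e.
have hB : bform B Y Y = 0.
  apply: inv_form_critical => // t pt.
  have e : M + t *: B = pencil A B (lm.1, lm.2 + t).
    by rewrite /M /pencil /= scalerDl !addrA.
  by rewrite e; apply: min; rewrite /pencil_dom /= -e.
have XM : X = M *m Y by rewrite mulKVmx.
have pencilE Z Z' : bform M Z Z' = dot Z Z' + lm.1 * bform A Z Z' + lm.2 * bform B Z Z'.
  by rewrite /M /pencil !bformD !bformZ bform1.
have h : dot Y (X - Y) = 0.
  rewrite dotBr [X in dot Y X]XM -bformE pencilE hA hB; ring.
split=> //.
have [l1 l2] := dom_bounded dlm.
have := posdef_inv_ge X X sM pM; rewrite pencilE [bform (invmx M) X X]bformE -/Y.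
have -> : dot (X - Y) (X - Y) = dot X X - dot X Y.
  by rewrite dotBl h subr0 dotBr.
have a1 : lm.1 * bform A X X <= `|bform A X X|.
  by rewrite (le_trans (ler_norm _)) // normrM ler_piMl.
have a2 : lm.2 * bform B X X <= 2 * `|bform B X X|.
  by rewrite (le_trans (ler_norm _)) // normrM ler_wpM2r.
by move=> ?; lra.
Qed.

Lemma cvg_bform (N : 'M[R]_m) (u v : nat -> 'cV[R]_m) (x y : 'cV[R]_m) :
  u k @[k --> \oo] --> x -> v k @[k --> \oo] --> y ->
  bform N (u k) (v k) @[k --> \oo] --> bform N x y.
Proof.
move=> ux vy; rewrite bform_sumE.
rewrite (_ : (fun k => bform N (u k) (v k)) =
    fun k => \sum_i \sum_j u k i 0 * (N i j * v k j 0)); last first.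
  by apply/funext => k; rewrite bform_sumE.
have coord (s : nat -> 'cV[R]_m) (z : 'cV[R]_m) i : s k @[k --> \oo] --> z ->
    s k i 0 @[k --> \oo] --> z i 0.
  by move=> /(continuous_cvg _ (@coord_continuous _ _ _ i 0 _)).
apply: cvg_big => [|i _]; first exact: add_continuous.
apply: cvg_big => [|j _]; first exact: add_continuous.
by apply: cvgM; [exact: coord|apply: cvgM; [exact: cvg_cst|exact: coord]].
Qed.

Lemma corrected_limit (u v : nat -> 'cV[R]_m) X Y :
  (forall k, corrected (u k) (v k)) ->
  u k @[k --> \oo] --> X -> v k @[k --> \oo] --> Y -> corrected X Y.
Proof.
move=> h ux vy.
have uv : (u k - v k) @[k --> \oo] --> X - Y by apply: cvgB.
have zero (f : nat -> R) (l : R) : f k @[k --> \oo] --> l -> (forall k, f k = 0) -> l = 0.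
  move=> fl f0; apply: (cvg_unique _ fl) => //.
  by rewrite (_ : f = fun=> 0); [exact: cvg_cst|apply/funext].
split.
- by apply: (zero (fun k => bform A (v k) (v k)) _ (@cvg_bform A _ _ _ _ vy vy)) => k;
    have [] := h k.
- by apply: (zero (fun k => bform B (v k) (v k)) _ (@cvg_bform B _ _ _ _ vy vy)) => k;
    have [] := h k.
- rewrite -bform1; apply: (zero (fun k => bform 1%:M (v k) (u k - v k)) _
    (@cvg_bform 1%:M _ _ _ _ vy uv)) => k.
  by rewrite bform1; have [] := h k.
- rewrite -bform1; apply: (ler_cvg_to (@cvg_bform 1%:M _ _ _ _ uv uv)).
    apply: cvgD; first by apply: cvg_norm; exact: (@cvg_bform A _ _ _ _ ux ux).
    apply: cvgM; first exact: cvg_cst.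
    by apply: cvg_norm; exact: (@cvg_bform B _ _ _ _ ux ux).
  by apply: nearW => k; rewrite bform1; have [] := h k.
Qed.

Lemma correction_corrected S chi X :
  correction A B S chi -> corrected X (chi X).
Proof.
move=> [hS hN]; have inS Z : S Z -> corrected Z (chi Z).
  by move=> /hS[lm min ->]; exact: pencil_min_corrected.
have [/inS //|/hN[u [uS uX vX]]] := pselect (S X).
by apply: corrected_limit uX vX => k; apply: inS.
Qed.

End CorrectedVectors.

(** * The two concrete pencils *)

Section TopForms.
Context {R : realType}.

Lemma bform_diag2 m n (M : 'M[R]_m) (N : 'M[R]_n) (X Y : 'cV[R]_(m + n)) :
  bform (diag2 M N) X Y =
  bform M (usubmx X) (usubmx Y) + bform N (dsubmx X) (dsubmx Y).
Proof.
rewrite /bform -{1}(vsubmxK X) -{1}(vsubmxK Y) /diag2 tr_col_mx.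
rewrite -mulmxA mul_block_col !mul0mx addr0 add0r mul_row_col !mulmxA.
by rewrite mxE.
Qed.

Lemma trmx_diag2 m n (M : 'M[R]_m) (N : 'M[R]_n) :
  (diag2 M N)^T = diag2 M^T N^T.
Proof. by rewrite /diag2 tr_block_mx !trmx0. Qed.

Lemma bform_Smx (u v : 'cV[R]_2) : bform (Smx : 'M[R]_2) u v = u 0 0 * v 0 0.
Proof.
rewrite bform_sumE !big_ord_recl !big_ord0 !mxE /=.
by rewrite !mul1r !mul0r !mulr0 !addr0.
Qed.

Lemma bform_Tmx (u v : 'cV[R]_2) :
  bform (Tmx : 'M[R]_2) u v = u 0 0 * v 1 0 + u 1 0 * v 0 0.
Proof.
rewrite bform_sumE !big_ord_recl !big_ord0 !mxE /=.
have -> : lift ord0 ord0 = 1 :> 'I_2 by apply: val_inj.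
by rewrite !addr0 !add0r !mul1r !mul0r !mulr0 !addr0 !add0r.
Qed.

Lemma bformN m (M : 'M[R]_m) u v : bform (- M) u v = - bform M u v.
Proof. by rewrite -scaleN1r bformZ mulN1r. Qed.

Lemma trmx_Smx : (Smx : 'M[R]_2)^T = Smx.
Proof. by rewrite /Smx trmx_delta. Qed.

Lemma trmx_Tmx : (Tmx : 'M[R]_2)^T = Tmx.
Proof. by rewrite /Tmx linearD /= !trmx_delta addrC. Qed.

Lemma crdE m (X : 'cV[R]_m.+1) (i : 'I_m.+1) : X i 0 = crd X (val i).
Proof. by rewrite /crd inord_val. Qed.

Lemma crd_colv m (s : seq R) k : (k <= m)%N -> crd (colv m.+1 s) k = s`_k.
Proof. by move=> km; rewrite /crd mxE inordK. Qed.

Lemma dot_crd m (X Y : 'cV[R]_m.+1) : dot X Y = \sum_(k < m.+1) crd X k * crd Y k.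
Proof. by rewrite dotE; apply: eq_bigr => k _; rewrite !crdE. Qed.

Lemma crdB m (X Y : 'cV[R]_m.+1) k : crd (X - Y) k = crd X k - crd Y k.
Proof. by rewrite /crd !mxE. Qed.

Lemma bform_A8 (X : 'cV[R]_8) : bform (A8 R) X X =
  crd X 0 ^+ 2 - crd X 2 ^+ 2 + crd X 4 ^+ 2 - crd X 6 ^+ 2.
Proof.
rewrite /A8 (@bform_diag2 4 4) !(@bform_diag2 2 2) !bformN !bform_Smx !mxE !crdE /=.
ring.
Qed.

Lemma bform_B8 (X : 'cV[R]_8) : bform (B8 R) X X =
  2 * (crd X 0 * crd X 1 - crd X 2 * crd X 3 + crd X 4 * crd X 5
       - crd X 6 * crd X 7).
Proof.
rewrite /B8 (@bform_diag2 4 4) !(@bform_diag2 2 2) !bformN !bform_Tmx !mxE !crdE /=.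
ring.
Qed.

Lemma bform_A6 (X : 'cV[R]_6) : bform (A6 R) X X =
  crd X 0 ^+ 2 - crd X 2 ^+ 2 + crd X 3 ^+ 2 - crd X 5 ^+ 2.
Proof.
rewrite /A6 (@bform_diag2 3 3) !(@bform_diag2 2 1) !bformN !bform_Smx !bform1.
rewrite !dotE !big_ord_recl !big_ord0 !mxE !crdE /=.
ring.
Qed.

Lemma bform_B6 (X : 'cV[R]_6) : bform (B6 R) X X =
  2 * (crd X 0 * crd X 1 + crd X 3 * crd X 4).
Proof.
rewrite /B6 (@bform_diag2 3 3) !(@bform_diag2 2 1) !bform_Tmx.
rewrite ![bform 0 _ _]bformE !mul0mx /dot !mulmx0 !mxE !crdE /=.
ring.
Qed.

Lemma trmx_A8 : (A8 R)^T = A8 R.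
Proof. by rewrite /A8 (@trmx_diag2 4 4) !(@trmx_diag2 2 2) !linearN /= !trmx_Smx. Qed.

Lemma trmx_B8 : (B8 R)^T = B8 R.
Proof. by rewrite /B8 (@trmx_diag2 4 4) !(@trmx_diag2 2 2) !linearN /= !trmx_Tmx. Qed.

Lemma trmx_A6 : (A6 R)^T = A6 R.
Proof. by rewrite /A6 (@trmx_diag2 3 3) !(@trmx_diag2 2 1) !linearN /= !trmx_Smx trmx1. Qed.

Lemma trmx_B6 : (B6 R)^T = B6 R.
Proof. by rewrite /B6 (@trmx_diag2 3 3) !(@trmx_diag2 2 1) !trmx_Tmx trmx0. Qed.

Lemma pencil_dom_gt0 m (A B : 'M[R]_m) lm v : pencil_dom A B lm -> v != 0 ->
  0 < dot v v + lm.1 * bform A v v + lm.2 * bform B v v.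
Proof.
by move=> /(_ v) h /h; rewrite -[X in 0 < X]/(bform _ v v) /pencil !bformD !bformZ bform1.
Qed.

Lemma colv_neq0 m (s : seq R) k : (k <= m)%N -> s`_k != 0 -> colv m.+1 s != 0.
Proof.
move=> km; apply: contra_neq => s0; rewrite -(crd_colv s km) s0.
by rewrite /crd mxE.
Qed.

(** The first coordinates of an [S] block and of a [- S] block bound [lm.1]; the
    vectors [(1, 1)] and [(1, -1)] in a [T] block bound [lm.2]. *)
Lemma dom_bounded8 lm : pencil_dom (A8 R) (B8 R) lm -> `|lm.1| <= 1 /\ `|lm.2| <= 2.
Proof.
move=> dlm.
have test s := @pencil_dom_gt0 _ _ _ lm (colv 8 s) dlm.
have h1 := test [:: 1] (@colv_neq0 7 [:: 1] 0 isT (oner_neq0 R)).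
have h2 := test [:: 0; 0; 1] (@colv_neq0 7 [:: 0; 0; 1] 2 isT (oner_neq0 R)).
have h3 := test [:: 1; 1] (@colv_neq0 7 [:: 1; 1] 0 isT (oner_neq0 R)).
have h4 := test [:: 1; -1] (@colv_neq0 7 [:: 1; -1] 0 isT (oner_neq0 R)).
move: h1 h2 h3 h4; rewrite !bform_A8 !bform_B8 !dot_crd.
rewrite !big_ord_recl !big_ord0 !crd_colv //= => h1 h2 h3 h4.
by rewrite !ler_norml; split; apply/andP; split; lra.
Qed.

Lemma dom_bounded6 lm : pencil_dom (A6 R) (B6 R) lm -> `|lm.1| <= 1 /\ `|lm.2| <= 2.
Proof.
move=> dlm.
have test s := @pencil_dom_gt0 _ _ _ lm (colv 6 s) dlm.
have h1 := test [:: 1] (@colv_neq0 5 [:: 1] 0 isT (oner_neq0 R)).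
have h2 := test [:: 0; 0; 1] (@colv_neq0 5 [:: 0; 0; 1] 2 isT (oner_neq0 R)).
have h3 := test [:: 1; 1] (@colv_neq0 5 [:: 1; 1] 0 isT (oner_neq0 R)).
have h4 := test [:: 1; -1] (@colv_neq0 5 [:: 1; -1] 0 isT (oner_neq0 R)).
move: h1 h2 h3 h4; rewrite !bform_A6 !bform_B6 !dot_crd.
rewrite !big_ord_recl !big_ord0 !crd_colv //= => h1 h2 h3 h4.
by rewrite !ler_norml; split; apply/andP; split; lra.
Qed.

End TopForms.

(** * The correction step *)

Section CorrectionStep.
Context {R : realType}.
Implicit Types (q r : quad R) (n : nat).

Notation T := (@chebT R).
Notation U := (@chebU R).

Definition topq n (a1 a0 b1 b0 c1 c0 d1 d0 : R) : quad R :=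
  (a1%:P * T n + a0%:P * T n.-1, b1%:P * U n + b0%:P * U n.-1,
   c1%:P * T n + c0%:P * T n.-1, d1%:P * U n + d0%:P * U n.-1).

Lemma wint_qM_topq_le n (a1 a0 b1 b0 c1 c0 d1 d0 : R) :
  wint (qM (topq n a1 a0 b1 b0 c1 c0 d1 d0)) <=
  2 * pi * (a1 ^+ 2 + a0 ^+ 2 + b1 ^+ 2 + b0 ^+ 2
            + c1 ^+ 2 + c0 ^+ 2 + d1 ^+ 2 + d0 ^+ 2).
Proof.
set s := (_ + _ in leRHS).
have -> : 2 * pi * s = wint (2 * s)%:P by rewrite wintC; ring.
apply: wint_le => x x01.
have lin (u v : R) (P Q : {poly R}) :
    (u%:P * P + v%:P * Q).[x] = u * P.[x] + v * Q.[x].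
  by rewrite hornerD !hornerM !hornerC.
rewrite hornerC horner_qM !lin.
have sqT k : (T k).[x] ^+ 2 <= 1.
  by rewrite -real_normK ?num_real // exprn_ile1 // chebT_le1.
have sqU k := chebU_sqr_le1 k x01.
have w0 := w_ge0 x01.
have par (u v y z W : R) : 0 <= W -> y ^+ 2 * W <= 1 -> z ^+ 2 * W <= 1 ->
    (u * y + v * z) ^+ 2 * W <= 2 * (u ^+ 2 + v ^+ 2).
  move=> W0 hy hz.
  have h1 : 0 <= u ^+ 2 * (1 - y ^+ 2 * W) by rewrite mulr_ge0 ?sqr_ge0 ?subr_ge0.
  have h2 : 0 <= v ^+ 2 * (1 - z ^+ 2 * W) by rewrite mulr_ge0 ?sqr_ge0 ?subr_ge0.
  have h3 : 0 <= (u * y - v * z) ^+ 2 * W by rewrite mulr_ge0 ?sqr_ge0.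
  have e : 2 * (u ^+ 2 + v ^+ 2) - (u * y + v * z) ^+ 2 * W =
    2 * (u ^+ 2 * (1 - y ^+ 2 * W)) + 2 * (v ^+ 2 * (1 - z ^+ 2 * W))
    + (u * y - v * z) ^+ 2 * W by ring.
  by rewrite -subr_ge0 e; lra.
have hT (u v : R) : (u * (T n).[x] + v * (T n.-1).[x]) ^+ 2 <= 2 * (u ^+ 2 + v ^+ 2).
  by rewrite -[leLHS]mulr1; apply: par; rewrite ?mulr1 ?ler01 ?sqT.
have hU (u v : R) : (u * (U n).[x] + v * (U n.-1).[x]) ^+ 2 * w.[x] <= 2 * (u ^+ 2 + v ^+ 2).
  exact: par.
apply: (le_trans (lerD (lerD (lerD (hT a1 a0) (hU b1 b0)) (hT c1 c0)) (hU d1 d0))).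
by rewrite /s -!mulrDr !addrA.
Qed.

Lemma wint_qB_topq n q (a1 a0 b1 b0 c1 c0 d1 d0 a1' a0' b1' b0' c1' c0' d1' d0' : R) :
  (1 < n)%N -> qtop n q a1 a0 b1 b0 c1 c0 d1 d0 ->
  wint (qB q (topq n a1' a0' b1' b0' c1' c0' d1' d0')) =
  (a1 * a1' + a0 * a0' + b1 * b1' + b0 * b0'
   + c1 * c1' + c0 * c0' + d1 * d1' + d0 * d0') * (pi / 2).
Proof.
case: q => [[[a b] c] d] n1 [/(wint_topT n1)[ea1 ea0] /(wint_topU n1)[eb1 eb0]].
move=> /(wint_topT n1)[ec1 ec0] /(wint_topU n1)[ed1 ed0].
transitivity (wint (a1' *: (a * T n) + a0' *: (a * T n.-1)
   + (b1' *: (b * U n * w) + b0' *: (b * U n.-1 * w))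
   + (c1' *: (c * T n) + c0' *: (c * T n.-1))
   + (d1' *: (d * U n * w) + d0' *: (d * U n.-1 * w)))).
  by congr wint; rewrite /qB /topq -!mul_polyC; ring.
rewrite !wintD !wintZ ea1 ea0 eb1 eb0 ec1 ec0 ed1 ed0; ring.
Qed.

Lemma topT_set_topT n (p : {poly R}) x y : topT n (set_topT n p x y) x y.
Proof.
rewrite /topT /set_topT; set A := \sum_(_ <= i < _) _.
rewrite [X in size (polyseq X)](_ : _ = A); last by rewrite -!mul_polyC; ring.
apply: (leq_trans (size_sum _ _ _)); apply/bigmax_leqP_seq => i.
rewrite mem_index_iota => /andP[_ ilt] _.
by rewrite (leq_trans (size_scale_leq _ _)) // size_chebT.
Qed.

Lemma topU_set_topU n (p : {poly R}) x y : topU n (set_topU n p x y) x y.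
Proof.
rewrite /topU /set_topU; set A := \sum_(_ <= i < _) _.
rewrite [X in size (polyseq X)](_ : _ = A); last by rewrite -!mul_polyC; ring.
apply: (leq_trans (size_sum _ _ _)); apply/bigmax_leqP_seq => i.
rewrite mem_index_iota => /andP[i1 ilt] _.
by rewrite (leq_trans (size_scale_leq _ _)) // size_chebU -ltnS prednK //
  (leq_trans i1) // ltnW.
Qed.

Lemma sub_set_topT n (p : {poly R}) x y : (0 < n)%N -> (size p <= n.+1)%N ->
  p - set_topT n p x y =
  (Tcoef p n - x)%:P * T n + (Tcoef p n.-1 - y)%:P * T n.-1.
Proof.
case: n => // n _ /Tcoef_sum {1}->; rewrite /set_topT.
rewrite [X in X - _]big_nat_recr //= [X in X + _ - _]big_nat_recr //=.
by rewrite !mul_polyC !scalerBl; ring.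
Qed.

Lemma sub_set_topU n (p : {poly R}) x y : (1 < n)%N -> (size p <= n)%N ->
  p - set_topU n p x y =
  (Ucoef p n - x)%:P * U n + (Ucoef p n.-1 - y)%:P * U n.-1.
Proof.
case: n => [|[|n]] // _ /Ucoef_sum {1}->; rewrite /set_topU.
rewrite [X in X - _]big_nat_recr //= [X in X + _ - _]big_nat_recr //=.
by rewrite !mul_polyC !scalerBl; ring.
Qed.

Lemma inQ_qtop n q a1 a0 b1 b0 c1 c0 d1 d0 : (0 < n)%N ->
  qtop n q a1 a0 b1 b0 c1 c0 d1 d0 -> inQ n q.
Proof.
case: q => [[[a b] c] d] n0 [ha hb hc hd].
by split; [exact: size_topT ha|exact: size_topU hb|exact: size_topT hc|exact: size_topU hd].
Qed.

End CorrectionStep.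

Section CorrectionSpec.
Context {R : realType}.
Implicit Types (q r : quad R) (n : nat).

Variables (chi6 : 'cV[R]_6 -> 'cV[R]_6) (chi8 : 'cV[R]_8 -> 'cV[R]_8).
Hypothesis corr6 : correction (A6 R) (B6 R) (S6 R) chi6.
Hypothesis corr8 : correction (A8 R) (B8 R) (S8 R) chi8.

(** The norm comparison starts at degree two: in degree one the coordinate on
    [T 0] carries the weight [pi] instead of [pi / 2], so that orthogonal
    coordinate vectors need not give orthogonal quadruplets. *)
Definition correction_step n q qh : Prop :=
  [/\ inQ n qh, (size (qM qh) <= (2 * n).-1)%N,
      wint (qM (q - qh)) <= 24 * wnorm (qM q - 1)
    & (1 < n)%N -> wint (qM qh) <= wint (qM q)].

Lemma pi_defect_bound (s x y e : R) :
  `|x / 2| * (pi / 2) <= e -> `|y| * (pi / 2) <= 2 * e -> s <= `|x| + 2 * `|y| ->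
  2 * pi * s <= 24 * e.
Proof.
rewrite normrM [`|2^-1|]ger0_norm // => hx hy hs.
have := ler_wpM2l (ltW (pi_gt0 R)) hs; move: (pi) hx hy => p hx hy; lra.
Qed.

(** The coordinates of indices [n] and [n.-1] all have weight [pi / 2], so the
    orthogonality of the coordinate vectors [Y] and [X - Y] is that of the
    quadruplets, and Pythagoras gives the norm comparison. *)
Lemma correction_step_ge2 n q : (1 < n)%N -> inQ n q ->
  correction_step n q (chi chi6 chi8 n q).
Proof.
case: q => [[[a b] c] d] n1 [sa sb sc sd].
have n0 : (0 < n)%N := ltnW n1.
pose X := top8 n (a, b, c, d); pose Y := chi8 X.
pose qh : quad R :=
  (set_topT n a (crd Y 0) (crd Y 1), set_topU n b (crd Y 2) (crd Y 3),
   set_topT n c (crd Y 4) (crd Y 5), set_topU n d (crd Y 6) (crd Y 7)).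
have -> : chi chi6 chi8 n (a, b, c, d) = qh.
  by rewrite /qh /Y /X; case: (n) n1 => [|[|k]].
have := correction_corrected (@trmx_A8 R) (@trmx_B8 R) (@dom_bounded8 R) X corr8.
rewrite -/Y => -[]; rewrite !bform_A8 !bform_B8 !dot_crd.
rewrite !big_ord_recr !big_ord0 /= !crdB !add0r.
have eX k : (k <= 7)%N -> crd X k = [:: Tcoef a n; Tcoef a n.-1; Ucoef b n;
    Ucoef b n.-1; Tcoef c n; Tcoef c n.-1; Ucoef d n; Ucoef d n.-1]`_k.
  by move=> k7; rewrite /X /top8 crd_colv.
move=> hA hB hd hs.
have topqh : qtop n qh (crd Y 0) (crd Y 1) (crd Y 2) (crd Y 3)
     (crd Y 4) (crd Y 5) (crd Y 6) (crd Y 7).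
  by split; [exact: topT_set_topT|exact: topU_set_topU|exact: topT_set_topT|
    exact: topU_set_topU].
have topqX : qtop n (a, b, c, d) (crd X 0) (crd X 1) (crd X 2) (crd X 3)
     (crd X 4) (crd X 5) (crd X 6) (crd X 7).
  rewrite !eX //=; have [yb [hb eb]] := topU_Ucoef n0 sb.
  have [yd [hd' ed]] := topU_Ucoef n0 sd; rewrite -eb // -ed //.
  by split=> //; apply: topT_Tcoef.
have dq : (a, b, c, d) - qh = topq n (crd X 0 - crd Y 0) (crd X 1 - crd Y 1)
    (crd X 2 - crd Y 2) (crd X 3 - crd Y 3) (crd X 4 - crd Y 4)
    (crd X 5 - crd Y 5) (crd X 6 - crd Y 6) (crd X 7 - crd Y 7).
  rewrite !eX // /topq /=; congr (_, _, _, _).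
  - exact: sub_set_topT.
  - exact: sub_set_topU.
  - exact: sub_set_topT.
  - exact: sub_set_topU.
have n2 : (1 < 2 * n)%N by rewrite (leq_trans n1) // leq_pmull.
have [dx dy] := topT_le_defect n2 (qM_top n1 topqX).
split.
- exact: inQ_qtop topqh.
- apply/topT_low; apply: topT_eq (qM_top n1 topqh) _ _.
    by rewrite hA mul0r.
  by apply/eqP; move/eqP: hB; rewrite mulf_eq0 pnatr_eq0.
- rewrite dq; apply: (le_trans (wint_qM_topq_le _ _ _ _ _ _ _ _ _)).
  apply: pi_defect_bound dx _ (le_trans _ hs).
    by rewrite normrM [`|2|]ger0_norm // -mulrA ler_pM2l.
  by rewrite !expr2.
- move=> _; have e : qM (a, b, c, d) = qM (qh + ((a, b, c, d) - qh)).
    by rewrite [qh + _]addrC subrK.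
  rewrite e qMD [wint (_ + 2 * _)]wintD [wint (qM _ + _)]wintD.
  rewrite -[2](polyC_natr R 2) mul_polyC wintZ [in qB _ _]dq.
  rewrite (wint_qB_topq _ _ _ _ _ _ _ _ n1 topqh) hd mul0r mulr0 addr0.
  by rewrite lerDl; apply: wint_ge0 => x; exact: qM_ge0.
Qed.

Lemma correction_step_1 q : inQ 1 q -> correction_step 1 q (chi chi6 chi8 1 q).
Proof.
case: q => [[[a b] c] d] [sa sb sc sd].
pose X := top6 (a, b, c, d); pose Y := chi6 X.
pose qh : quad R :=
  (crd Y 0 *: chebT 1 + (crd Y 1)%:P, crd Y 2 *: chebU 1,
   crd Y 3 *: chebT 1 + (crd Y 4)%:P, crd Y 5 *: chebU 1).
rewrite -[chi _ _ _ _]/qh.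
have := correction_corrected (@trmx_A6 R) (@trmx_B6 R) (@dom_bounded6 R) X corr6.
rewrite -/Y => -[]; rewrite !bform_A6 !bform_B6 !dot_crd.
rewrite !big_ord_recr !big_ord0 /= !crdB !add0r.
have eX k : (k <= 5)%N -> crd X k = [:: Tcoef a 1; Tcoef a 0; Ucoef b 1;
    Tcoef c 1; Tcoef c 0; Ucoef d 1]`_k.
  by move=> k5; rewrite /X /top6 crd_colv.
move=> hA hB hd hs.
have tT x y : topT 1 (x *: chebT 1 + y%:P : {poly R}) x y.
  have e : chebT 0 = 1 :> {poly R} by [].
  by rewrite /topT /= e mulr1 mul_polyC subrr size_poly0.
have tU x : topU 1 (x *: chebU 1 : {poly R}) x 0.
  by rewrite /topU polyC0 mul0r addr0 mul_polyC subrr size_poly0.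
have topqh : qtop 1 qh (crd Y 0) (crd Y 1) (crd Y 2) 0
     (crd Y 3) (crd Y 4) (crd Y 5) 0 by split.
have Uex (p : {poly R}) : (size p <= 1)%N -> topU 1 p (Ucoef p 1) 0.
  move=> /Ucoef_sum {1}->; rewrite big_nat1; exact: tU.
have topqX : qtop 1 (a, b, c, d) (crd X 0) (crd X 1) (crd X 2) 0
     (crd X 3) (crd X 4) (crd X 5) 0.
  rewrite !eX //=.
  by split; [exact: (@topT_Tcoef _ 1)|exact: Uex|exact: (@topT_Tcoef _ 1)|exact: Uex].
have exact1 (p : {poly R}) x y : topT 1 p x y -> p = x%:P * chebT 1 + y%:P * chebT 0.
  by rewrite /topT /= => /size_poly_leq0P/eqP; rewrite subr_eq0 => /eqP.
have exactU (p : {poly R}) x y : topU 1 p x y -> p = x%:P * chebU 1 + y%:P * chebU 0.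
  by rewrite /topU /= => /size_poly_leq0P/eqP; rewrite subr_eq0 => /eqP.
have dq : (a, b, c, d) - qh = topq 1 (crd X 0 - crd Y 0) (crd X 1 - crd Y 1)
    (crd X 2 - crd Y 2) 0 (crd X 3 - crd Y 3) (crd X 4 - crd Y 4)
    (crd X 5 - crd Y 5) 0.
  move: topqX topqh; rewrite /qtop /qh.
  move=> [/exact1 {1}-> /exactU {1}-> /exact1 {1}-> /exactU {1}->].
  move=> [/exact1 -> /exactU -> /exact1 -> /exactU ->].
  rewrite /topq [1.-1]/=; congr (_, _, _, _); rewrite !polyCB /=; ring.
have [dx dy] := @topT_le_defect R 2 _ _ _ isT (qM_top1 topqX).
split=> //.
- exact: inQ_qtop topqh.
- apply/(topT_low 2); apply: topT_eq (qM_top1 topqh) _ hB.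
  by rewrite hA mul0r.
- rewrite dq; apply: (le_trans (wint_qM_topq_le _ _ _ _ _ _ _ _ _)).
  apply: pi_defect_bound dx (le_trans dy _) (le_trans _ hs).
    have := wnorm_ge0 (qM (a, b, c, d) - 1); lra.
  by rewrite expr0n /= !addr0 !expr2.
Qed.

Lemma chi_correction_step n q : (0 < n)%N -> inQ n q ->
  correction_step n q (chi chi6 chi8 n q).
Proof.
case: n => [|[|n]] // _ h; first exact: correction_step_1.
exact: correction_step_ge2.
Qed.

End CorrectionSpec.

(** * Quaternionic multiplication *)

Section QuadAlgebra.
Context {R : realType}.
Implicit Types (q r e : quad R) (n : nat).

Lemma qM_qmul r q : qM (qmul r q) = qM r * qM q.
Proof.
case: r q => [[[? ?] ?] ?] [[[? ?] ?] ?]; rewrite /qM /qmul; ring.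
Qed.

Lemma qM_qconj q : qM (qconj q) = qM q.
Proof. by case: q => [[[a b] c] d]; rewrite /qM /qconj !sqrrN. Qed.

Lemma qmul_conjK e q : qM e = 1 -> qmul (qconj e) (qmul e q) = q.
Proof.
case: e q => [[[al be] ga] de] [[[a b] c] d] h.
rewrite -[RHS]/(a, b, c, d) -[a in RHS]mul1r -[b in RHS]mul1r.
rewrite -[c in RHS]mul1r -[d in RHS]mul1r -h.
rewrite /qmul /qconj /qM; congr (_, _, _, _); ring.
Qed.

Lemma qmul_conjl q : qmul (qconj q) q = (qM q, 0, 0, 0).
Proof.
case: q => [[[a b] c] d]; rewrite /qmul /qconj /qM; congr (_, _, _, _); ring.
Qed.

Lemma qmul1 q : qmul qone q = q.
Proof.
case: q => [[[a b] c] d]; rewrite /qmul /qone; congr (_, _, _, _); ring.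
Qed.

Lemma qmulBr e q r : qmul e (q - r) = qmul e q - qmul e r.
Proof.
case: e q r => [[[? ?] ?] ?] [[[? ?] ?] ?] [[[? ?] ?] ?].
rewrite /qmul /=; congr (_, _, _, _); rewrite /=; ring.
Qed.

Lemma qmulZl (k : R) e q : qmul (k *: e) q = k *: qmul e q.
Proof.
case: e q => [[[? ?] ?] ?] [[[? ?] ?] ?].
by rewrite /qmul /=; congr (_, _, _, _); rewrite -!mul_polyC /=; ring.
Qed.

Lemma inQZ n (k : R) q : inQ n q -> inQ n (k *: q).
Proof.
case: q => [[[a b] c] d] [sa sb sc sd] /=.
by split; apply: leq_trans (size_scale_leq _ _) _.
Qed.

Lemma inQ_conj n q : inQ n q -> inQ n (qconj q).
Proof. by case: q => [[[a b] c] d] [sa sb sc sd]; split; rewrite ?size_polyN. Qed.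

Lemma inQ_qmul1 n e q : inQ 1 e -> inQ n q -> inQ n.+1 (qmul e q).
Proof.
case: e q => [[[al be] ga] de] [[[a b] c] d] [s1 s2 s3 s4] [t1 t2 t3 t4].
have m2 (p r : {poly R}) k : (size p <= 2)%N -> (size r <= k)%N -> (size (p * r)%R <= k.+1)%N.
  by move=> hp hr; apply: (size_mul_le hp hr).
have m1 (p r : {poly R}) k : (size p <= 1)%N -> (size r <= k)%N -> (size (p * r)%R <= k)%N.
  by move=> hp hr; apply: (size_mul_le hp hr).
have mw (p r : {poly R}) k : (size p <= 1)%N -> (size r <= k)%N -> (size (p * r * w)%R <= k.+2)%N.
  by move=> hp hr; apply: (size_mul_le (m1 _ _ _ hp hr) size_w); rewrite addn3.
have up (p : {poly R}) k : (size p <= k)%N -> (size p <= k.+1)%N by apply: leqW.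
split; repeat (apply: size_sub_le || apply: size_add_le);
  by [exact: m2|exact: mw|apply: m1|apply: up; apply: m1].
Qed.

End QuadAlgebra.

(** * The factorization step *)

Section FactorStep.
Context {R : realType}.
Implicit Types (q r e : quad R) (n : nat).

Notation T := (@chebT R).
Notation U := (@chebU R).

Lemma size_topT0 n (p : {poly R}) y : (0 < n)%N -> topT n p 0 y -> (size p <= n)%N.
Proof.
rewrite /topT polyC0 mul0r add0r => n0 h; rewrite -(subrK (y%:P * T n.-1) p).
apply: size_add_le; first by rewrite (leq_trans h) // leq_pred.
by apply: size_Cmul_le; rewrite size_chebT prednK.
Qed.

Lemma size_topU0 n (p : {poly R}) y : topU n p 0 y -> (size p <= n.-1)%N.
Proof.
rewrite /topU polyC0 mul0r add0r => h; rewrite -(subrK (y%:P * U n.-1) p).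
apply: size_add_le; first by rewrite (leq_trans h) // leq_pred.
by apply: size_Cmul_le; rewrite size_chebU.
Qed.

Lemma qM_eq0 q : qM q = 0 -> q = 0.
Proof.
case: q => [[[a b] c] d] M0.
have h x : 0 < x < 1 ->
    [/\ a.[x] = 0, b.[x] = 0, c.[x] = 0 & d.[x] = 0].
  move=> x01; have w0 := w_gt0 x01.
  have := horner_qM a b c d x; rewrite M0 horner0.
  have a0 := sqr_ge0 a.[x]; have b0 := sqr_ge0 b.[x].
  have c0 := sqr_ge0 c.[x]; have d0 := sqr_ge0 d.[x].
  have bw := mulr_ge0 b0 (ltW w0); have dw := mulr_ge0 d0 (ltW w0).
  move=> e; have sq z : z ^+ 2 = 0 -> z = 0 :> R.
    by move/eqP; rewrite sqrf_eq0 => /eqP.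
  have sqw z : z ^+ 2 * w.[x] = 0 -> z = 0 :> R.
    by move/eqP; rewrite mulf_eq0 (gt_eqF w0) orbF sqrf_eq0 => /eqP.
  by split; [apply: sq|apply: sqw|apply: sq|apply: sqw]; lra.
have z (p : {poly R}) : (forall x, 0 < x < 1 -> p.[x] = 0) -> p = 0.
  by move=> p0; apply: poly_eq_unit_itv => x /p0 ->; rewrite horner0.
rewrite (z a); last by move=> x /h[].
rewrite (z b); last by move=> x /h[].
rewrite (z c); last by move=> x /h[].
by rewrite (z d) // => x /h[].
Qed.

Definition factor_step n q e : Prop :=
  [/\ inQ 1 e, qM e = 1 & inQ n.-1 (qmul e q)].

Lemma inQ_qone n : inQ n (@qone R).
Proof. by rewrite /qone; split; rewrite ?size_poly1 ?size_poly0. Qed.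

Lemma qM_qone : qM (@qone R) = 1.
Proof. by rewrite /qM /qone !expr0n /= !mul0r !addr0 expr1n. Qed.

Lemma factor_step_1 q : inQ 1 q -> (size (qM q) <= 1)%N -> q != 0 ->
  factor_step 1 q ((Num.sqrt (qM q)`_0)^-1 *: qconj q).
Proof.
move=> sq sM q0; set m := (qM q)`_0.
have eM : qM q = m%:P by rewrite /m; apply: size1_polyC.
have m0 : 0 <= m.
  have /(qM_ge0 q) : 0 <= (0 : R) <= 1 by rewrite lexx ler01.
  by rewrite eM hornerC.
have mn0 : m != 0.
  by apply: contra_neq q0 => m00; apply: qM_eq0; rewrite eM m00.
have K1 : (Num.sqrt m)^-1 ^+ 2 * m = 1 by rewrite exprVn sqr_sqrtr // mulVf.
split.
- by apply/inQZ/inQ_conj.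
- by rewrite qMZ qM_qconj eM -mul_polyC -polyCM K1 polyC1.
- rewrite qmulZl qmul_conjl eM; apply: inQZ.
  by split; rewrite ?size_poly0 // size_polyC_leq1.
Qed.

(** The vanishing of the two top coordinates of [qM q] makes those of the product
    vanish too, once [al0] and [ga0] are chosen as below; [p] and [r] are the
    quotients that enter them, kept free of denominators. *)
Lemma factor_step_ge2 n q (a a' b b' c c' d d' p r al0 ga0 : R) :
  (1 < n)%N -> qtop n q a a' b b' c c' d d' ->
  a ^+ 2 - b ^+ 2 + c ^+ 2 - d ^+ 2 = 0 ->
  a * a' - b * b' + c * c' - d * d' = 0 ->
  0 < a ^+ 2 + c ^+ 2 ->
  p * (a ^+ 2 + c ^+ 2) = (b * b' + d * d') / 2 ->
  r * (a ^+ 2 + c ^+ 2) = (b * d' - d * b') / 2 ->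
  al0 = a' / 2 - p * a + r * c ->
  ga0 = - (c' / 2) + p * c + r * a ->
  factor_step n q ((Num.sqrt (al0 ^+ 2 + ga0 ^+ 2
       + 2^-1 * (a ^+ 2 + (- b) ^+ 2 + (- c) ^+ 2 + (- d) ^+ 2)))^-1 *:
     ((a *: T 1 + al0%:P, - b *: U 1, - c *: T 1 + ga0%:P, - d *: U 1) : quad R)).
Proof.
move=> n1; case: q => [[[pa pb] pc] pd] [ha hb hc hd] hs hP s0 hp hr e1 e2.
set k := _ + 2^-1 * _.
have hs' : a ^+ 2 + c ^+ 2 = b ^+ 2 + d ^+ 2
  by apply/eqP; rewrite -subr_eq0 -hs; apply/eqP; ring.
have k0 : 0 < k.
  rewrite /k !sqrrN; have := sqr_ge0 al0; have := sqr_ge0 ga0.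
  have := sqr_ge0 b; have := sqr_ge0 d; lra.
have K1 : (Num.sqrt k)^-1 ^+ 2 * k = 1.
  by rewrite exprVn sqr_sqrtr ?ltW // mulVf // gt_eqF.
have sT (u v : R) : (size (u *: T 1 + v%:P)%R <= 2)%N.
  apply: size_add_le; first by rewrite -mul_polyC; apply: size_Cmul_le; rewrite size_chebT.
  by rewrite (leq_trans (size_polyC_leq1 _)).
have sU (u : R) : (size (u *: U 1)%R <= 1)%N.
  by rewrite -mul_polyC; apply: size_Cmul_le; rewrite size_chebU.
split.
- by apply: inQZ; split; rewrite ?sT ?sU.
- rewrite qMZ (_ : qM _ = k%:P); first by rewrite -mul_polyC -polyCM K1.
  rewrite /qM -!mul_polyC.
  have -> : T 1 = 2%:P * 'X - 1 by rewrite mul_polyC.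
  have -> : U 1 = 2%:P by [].
  have lin0 : a * al0 - c * ga0 = 0.
    have -> : a * al0 - c * ga0 = (a * a' + c * c') / 2 - p * (a ^+ 2 + c ^+ 2).
      by rewrite e1 e2; ring.
    rewrite hp; transitivity ((a * a' - b * b' + c * c' - d * d') / 2); first by ring.
    by rewrite hP mul0r.
  have kE : k = al0 ^+ 2 + ga0 ^+ 2 + (a ^+ 2 + c ^+ 2).
    by rewrite /k !sqrrN hs'; lra.
  rewrite kE /w.
  transitivity ((al0 ^+ 2 + ga0 ^+ 2 + (a ^+ 2 + c ^+ 2))%:P
     + 2 * (a * al0 - c * ga0)%:P * (2%:P * 'X - 1)
     - (a ^+ 2 - b ^+ 2 + c ^+ 2 - d ^+ 2)%:P * 4 * ('X * (1 - 'X))).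
    rewrite !(expr2, polyCD, polyCN, polyCM). ring.
  by rewrite lin0 hs polyC0 mulr0 !mul0r addr0 subr0.
- rewrite qmulZl; apply: inQZ.
  have tA := topTD (topTD (topTD (topT_mul_linear a al0 n1 ha)
     (topTN (topT_mulU1 (- b) n1 hb))) (topTN (topT_mul_linear (- c) ga0 n1 hc)))
     (topTN (topT_mulU1 (- d) n1 hd)).
  have tB := topUD (topUD (topUD (topU_mulU1 (- b) n1 ha)
     (topU_mul_linear a al0 n1 hb)) (topUN (topU_mulU1 (- d) n1 hc)))
     (topU_mul_linear (- c) ga0 n1 hd).
  have tC := topTD (topTD (topTD (topT_mul_linear (- c) ga0 n1 ha)
     (topT_mulU1 (- d) n1 hb)) (topT_mul_linear a al0 n1 hc))
     (topTN (topT_mulU1 (- b) n1 hd)).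
  have tD := topUD (topUD (topUD (topU_mulU1 (- d) n1 ha)
     (topUN (topU_mul_linear (- c) ga0 n1 hb))) (topU_mulU1 (- b) n1 hc))
     (topU_mul_linear a al0 n1 hd).
  have n0 : (0 < n)%N by apply: ltnW.
  rewrite /inQ /qmul prednK //; split.
  + apply/(topT_low n.+1); apply: topT_eq tA _ _.
      transitivity ((a ^+ 2 - b ^+ 2 + c ^+ 2 - d ^+ 2) / 2); first by ring.
      by rewrite hs mul0r.
    transitivity ((a * a' + c * c') - (b * b' + d * d') / 2 - p * (a ^+ 2 + c ^+ 2)).
      by rewrite e1 e2; field.
    rewrite hp; transitivity (a * a' - b * b' + c * c' - d * d'); first by field.
    exact: hP.
  + apply/(topU_low n.+1); apply: topU_eq tB _ _; first by ring.
    apply: (mulIf (lt0r_neq0 s0)); rewrite mul0r.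
    transitivity ((a ^+ 2 + c ^+ 2) * (a * b' - c * d') / 2
      - p * (a ^+ 2 + c ^+ 2) * (a * b - c * d)
      + r * (a ^+ 2 + c ^+ 2) * (c * b + a * d)); first by rewrite e1 e2; field.
    by rewrite hp hr hs'; ring.
  + apply/(topT_low n.+1); apply: topT_eq tC _ _; first by ring.
    transitivity (r * (a ^+ 2 + c ^+ 2) - (b * d' - d * b') / 2).
      by rewrite e1 e2; field.
    by rewrite hr subrr.
  + apply/(topU_low n.+1); apply: topU_eq tD _ _; first by ring.
    apply: (mulIf (lt0r_neq0 s0)); rewrite mul0r.
    transitivity ((a ^+ 2 + c ^+ 2) * (c * b' + a * d') / 2
      - p * (a ^+ 2 + c ^+ 2) * (c * b + a * d)
      + r * (a ^+ 2 + c ^+ 2) * (c * d - a * b)); first by rewrite e1 e2; field.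
    by rewrite hp hr hs'; ring.
Qed.

Lemma phi_factor_step n q : (0 < n)%N -> inQ n q -> (size (qM q) <= (2 * n).-1)%N ->
  factor_step n q (phi n q).
Proof.
case: q => [[[a b] c] d] n0 sq sM; have [sa sb sc sd] := sq.
set q := (a, b, c, d).
have [yb [hb eb]] := topU_Ucoef n0 sb; have [yd [hd ed]] := topU_Ucoef n0 sd.
have tq : qtop n q (Tcoef a n) (Tcoef a n.-1) (Ucoef b n) yb
    (Tcoef c n) (Tcoef c n.-1) (Ucoef d n) yd.
  by split=> //; apply: topT_Tcoef.
have top0 : topT (2 * n) (qM q) 0 0 by apply/topT_low.
have nn0 : (0 < 2 * n)%N by rewrite muln_gt0.
have [u0 v0] := topT_coef nn0 top0.
have hs : Tcoef a n ^+ 2 - Ucoef b n ^+ 2 + Tcoef c n ^+ 2 - Ucoef d n ^+ 2 = 0.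
  apply: (@mulIf _ (2^-1)); rewrite ?invr_eq0 ?pnatr_eq0 // mul0r.
  have [n1|] := ltnP 1 n.
    by have [-> _] := topT_coef nn0 (qM_top n1 tq).
  move=> n1; have en : n = 1%N by apply/eqP; rewrite eqn_leq n1.
  move: tq u0; rewrite en => tq u0.
  by have [-> _] := @topT_coef _ 2 _ _ _ isT (qM_top1 tq).
rewrite /phi -/q; case: ifP => [/eqP s0|/negbT s0].
  have sq0 (x y : R) : x ^+ 2 + y ^+ 2 = 0 -> x = 0 /\ y = 0.
    by move/eqP; rewrite paddr_eq0 ?sqr_ge0 // !sqrf_eq0 => /andP[/eqP -> /eqP ->].
  have [a0 c0] := sq0 _ _ s0.
  have [b0 d0] : Ucoef b n = 0 /\ Ucoef d n = 0.
    by apply: sq0; move: hs; rewrite a0 c0; lra.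
  split; [exact: inQ_qone|exact: qM_qone|rewrite qmul1].
  move: tq; rewrite a0 b0 c0 d0 => -[ta tb tc td]; split; rewrite ?prednK //.
  - exact: size_topT0 ta.
  - exact: size_topU0 tb.
  - exact: size_topT0 tc.
  - exact: size_topU0 td.
case: ifP => [/eqP en|/negbT nn1].
  move: sq sM s0 tq; rewrite en => sq sM s0 tq; apply: factor_step_1 => //.
  apply: contraNneq s0 => -[ea _ ec _].
  have z0 : Tcoef (0 : {poly R}) 1 = 0.
    have t0 : topT 1 (0 : {poly R}) 0 0 by apply/topT_low; rewrite size_poly0.
    by have [<-] := @topT_coef _ 1 _ _ _ isT t0.
  by rewrite ea ec z0 expr0n addr0.
have n1 : (1 < n)%N by rewrite ltn_neqAle eq_sym nn1.
have s1 : 0 < Tcoef a n ^+ 2 + Tcoef c n ^+ 2.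
  by rewrite lt_neqAle eq_sym s0 addr_ge0 ?sqr_ge0.
move: tq; rewrite eb // ed // => tq.
apply: (factor_step_ge2 n1 tq hs _ s1 _ _ erefl erefl).

- have [e1 e2] := topT_coef nn0 (qM_top n1 tq).
  by rewrite e2 -v0.
- by field.
- by field.
Qed.

End FactorStep.

(** * The projection *)

Section Projection.
Context {R : realType}.
Implicit Types (q r e : quad R) (n : nat).

(** For a constant of modulus [k] the claim is [(k - 1) ^+ 2 <= `|k ^+ 2 - 1|]. *)
Lemma normalize0_spec q : inQ 0 q ->
  [/\ inQ 0 (normalize0 q), qM (normalize0 q) = 1
    & wint (qM (q - normalize0 q)) <= wnorm (qM q - 1)].
Proof.
move=> sq; have eM : qM q = ((qM q)`_0)%:P.
  apply: size1_polyC; case: q sq => [[[a b] c] d] [sa sb sc sd].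
  move/size_poly_leq0P: sb => ->; move/size_poly_leq0P: sd => ->; rewrite /qM.
  rewrite expr0n /= mul0r !addr0 !expr2.
  by apply: size_add_le; [apply: (size_mul_le sa sa)|apply: (size_mul_le sc sc)].
rewrite /normalize0; have [->|q0] := eqVneq q 0.
  split; [exact: (@inQ_qone R 0)|exact: qM_qone|].
  rewrite sub0r qMN qM_qone wint1.
  have -> : qM (0 : quad R) = 0 by rewrite /qM /= !expr0n /= !mul0r !addr0.
  rewrite sub0r wnormN -[leLHS]wint1; exact: wint_le_wnorm.
move: eM; set m := (qM q)`_0 => eM.
have m0 : 0 <= m.
  have /(qM_ge0 q) : 0 <= (0 : R) <= 1 by rewrite lexx ler01.
  by rewrite eM hornerC.
have mn0 : m != 0.
  by apply: contra_neq q0 => m00; apply: qM_eq0; rewrite eM m00.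
set k := Num.sqrt m.
have k0 : 0 < k by rewrite sqrtr_gt0 lt_neqAle eq_sym mn0.
have kk : k ^+ 2 = m by rewrite sqr_sqrtr.
split.
- exact: inQZ.
- by rewrite qMZ eM -mul_polyC -polyCM -kk exprVn mulVf ?polyC1 // kk.
- have -> : q - k^-1 *: q = (1 - k^-1) *: q by rewrite scalerBl scale1r.
  rewrite qMZ eM wintZ wintC -polyC1 -polyCB.
  apply: (le_trans _ (abs_wint_le_wnorm _)); rewrite wintC normrM (ger0_norm (pi_ge0 R)).
  rewrite mulrA; apply: ler_wpM2r; first exact: pi_ge0.
  have -> : (1 - k^-1) ^+ 2 * m = (k - 1) ^+ 2.
    by rewrite -kk -exprMn mulrBl mul1r mulVf // gt_eqF.
  have -> : m - 1 = (k - 1) * (k + 1) by rewrite -kk; ring.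
  rewrite -(ger0_norm (sqr_ge0 (k - 1))) expr2 !normrM.
  apply: ler_wpM2l => //; rewrite (ger0_norm (addr_ge0 (ltW k0) ler01)).
  by rewrite ler_norml; apply/andP; split; lra.
Qed.

Variables (chi6 : 'cV[R]_6 -> 'cV[R]_6) (chi8 : 'cV[R]_8 -> 'cV[R]_8).
Hypothesis corr6 : correction (A6 R) (B6 R) (S6 R) chi6.
Hypothesis corr8 : correction (A8 R) (B8 R) (S8 R) chi8.

Notation proj := (quad_proj chi6 chi8).

Lemma quad_proj_unit n q : inQ n q -> inQ n (proj n q) /\ qM (proj n q) = 1.
Proof.
elim: n q => [|n IH] q sq; first by have [] := normalize0_spec sq.
have [sqh sM _ _] := chi_correction_step corr6 corr8 (ltn0Sn n) sq.
have [se Me sp] := phi_factor_step (ltn0Sn n) sqh sM.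
rewrite [quad_proj _ _ _ _]/=; have [s1 M1] := IH _ sp.
split; first by apply: inQ_qmul1 => //; apply: inQ_conj.
by rewrite qM_qmul qM_qconj Me mul1r M1.
Qed.

Definition defect q : R := wnorm (qM q - 1).

Lemma defect_le q : defect q <= qnorm q ^+ 2 + pi.
Proof.
rewrite sqr_qnorm -wnorm_qM /defect; apply: (le_trans (wnormD _ _)).
rewrite wnormN lerD2l -wint1; apply: wnorm_le_wint => x _.
by rewrite hornerC normr1.
Qed.

Lemma defect_perturb q r :
  defect r <= defect q + qnorm (q - r) * (qnorm q + qnorm r).
Proof.
have -> : defect r = wnorm ((qM q - 1) + - (qM q - qM r)).
  by congr wnorm; ring.
apply: (le_trans (wnormD _ _)); rewrite wnormN lerD2l qM_sub.
apply: (le_trans (wnorm_qB _ _)); apply: ler_wpM2l; first exact: qnorm_ge0.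
exact: qnormD.
Qed.

Variable H : R.
Hypothesis H0 : 0 <= H.

(* [26 = 1 + 5 ^ 2] and [10 = 2 * 5] come from [s ^+ 2 + 5 s (2 H + 5 s)]. *)
Let L : R := 26 * (H ^+ 2 + pi + 1) + 10 * H.

(** The defect moves by at most [qnorm (q - qh) * (qnorm q + qnorm qh)], which is
    linear in [s = sqrt (defect q)] up to a term [s ^+ 2]; that term is linear in
    [s] as well, because [H] bounds [s]. *)
Lemma chi_step n q : (0 < n)%N -> inQ n q -> qnorm q <= H ->
  qnorm (q - chi chi6 chi8 n q) <= 5 * Num.sqrt (defect q) /\
  defect (chi chi6 chi8 n q) <= L * Num.sqrt (defect q).
Proof.
move=> n0 sq qH; have [_ _ hE _] := chi_correction_step corr6 corr8 n0 sq.
set qh := chi _ _ n q in hE *; set s := Num.sqrt _.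
have d0 : 0 <= defect q := wnorm_ge0 _.
have ss : s ^+ 2 = defect q by rewrite sqr_sqrtr.
have s0 : 0 <= s := sqrtr_ge0 _.
have qn0 := qnorm_ge0 q.
(* The constant 24 of the correction step is at most [5 ^ 2]. *)
have h1 : qnorm (q - qh) <= 5 * s.
  rewrite -(@ler_pXn2r _ 2) ?nnegrE ?qnorm_ge0 ?mulr_ge0 // sqr_qnorm exprMn ss.
  by apply: (le_trans hE); rewrite -/(defect q); nra.
split=> //.
have h2 : qnorm qh <= H + 5 * s.
  have -> : qh = q + - (q - qh) by rewrite opprB addrC subrK.
  by rewrite (le_trans (qnormD _ _)) // qnormN lerD.
have sb : s <= H ^+ 2 + pi + 1.
  have := defect_le q; have : qnorm q ^+ 2 <= H ^+ 2 by rewrite lerXn2r ?nnegrE.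
  have := sqr_ge0 (s - 1); rewrite -ss; move: (pi) => p; nra.
apply: (le_trans (defect_perturb q qh)); rewrite -ss.
apply: (@le_trans _ _ (s ^+ 2 + (5 * s) * (H + (H + 5 * s)))).
  rewrite lerD2l; apply: ler_pM; rewrite ?qnorm_ge0 ?addr_ge0 ?qnorm_ge0 //.
  exact: lerD.
have := ler_wpM2r s0 sb; rewrite /L; move: (pi) => p; nra.
Qed.

Let K : R := L + 1.

Let L_ge0 : 0 <= L.
Proof.
have h : 0 <= H ^+ 2 + pi + 1 by do 2! apply: addr_ge0 => //; [exact: sqr_ge0|exact: pi_ge0].
by apply: addr_ge0; apply: mulr_ge0.
Qed.

(** Each degree drop replaces the defect by a multiple of its square root; the
    constant [K] absorbs that multiple because [L * K <= K ^+ 2]. *)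
Lemma proj_dist n q x : inQ n q -> ((0 < n)%N -> qnorm q <= H) -> 0 <= x <= 1 ->
  Num.sqrt (defect q) <= K * x ^+ (2 ^ n) ->
  qnorm (q - proj n q) <= n.+1%:R * (5 * K * x).
Proof.
have K0 : 0 <= K by rewrite addr_ge0.
elim: n q => [|n IH] q sq qH /andP[x0 x1] dq.
  have [_ _ h] := normalize0_spec sq; rewrite mul1r /=.
  have d0 : 0 <= defect q := wnorm_ge0 _.
  apply: (@le_trans _ _ (Num.sqrt (defect q))).
    by rewrite /qnorm wnorm_qM; apply: ler_wsqrtr.
  by apply: (le_trans dq); rewrite expn0 expr1 -mulrA ler_peMl ?mulr_ge0 // ler1n.
have [h1 h2] := chi_step (ltn0Sn n) sq (qH isT).
have [sqh sM _ hN] := chi_correction_step corr6 corr8 (ltn0Sn n) sq.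
have [se Me sp] := phi_factor_step (ltn0Sn n) sqh sM.
rewrite [quad_proj _ _ _ _]/=; set qh := chi _ _ _ q in h1 h2 sqh sM hN se Me sp *.
set e := phi _ qh in se Me sp *; set q1 := qmul e qh in sp *.
have xn1 : x ^+ (2 ^ n) <= 1 by apply: exprn_ile1.
have xn0 : 0 <= x ^+ (2 ^ n) by apply: exprn_ge0.
have xn : x ^+ (2 ^ n.+1) = (x ^+ (2 ^ n)) ^+ 2 by rewrite expnS mulnC exprM.
have q1H : (0 < n)%N -> qnorm q1 <= H.
  move=> n0; apply: le_trans (qH isT).
  rewrite (@qnormE _ q1 qh) ?qM_qmul ?Me ?mul1r // /qnorm !wnorm_qM.
  by apply: ler_wsqrtr; apply: hN.
have d1 : Num.sqrt (defect q1) <= K * x ^+ (2 ^ n).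
  have kx : 0 <= K * x ^+ (2 ^ n) by apply: mulr_ge0.
  rewrite -(ger0_norm kx) -sqrtr_sqr; apply: ler_wsqrtr.
  have -> : defect q1 = defect qh by rewrite /defect qM_qmul Me mul1r.
  apply: (le_trans h2); apply: (le_trans (ler_wpM2l L_ge0 dq)).
  rewrite xn exprMn mulrA; apply: ler_wpM2r; first exact: sqr_ge0.
  by rewrite expr2; apply: ler_wpM2r => //; rewrite lerDl.
have := IH q1 sp q1H; rewrite x0 x1 => /(_ isT d1) hI.
have -> : q - qmul (qconj e) (proj n q1) = (q - qh) + qmul (qconj e) (q1 - proj n q1).
  by rewrite qmulBr qmul_conjK // addrA subrK.
apply: (le_trans (qnormD _ _)).
rewrite (@qnormE _ (qmul (qconj e) _) (q1 - proj n q1)); last first.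
  by rewrite qM_qmul qM_qconj Me mul1r.
rewrite -[n.+2%:R]natr1 mulrDl mul1r addrC; apply: lerD => //.
apply: (le_trans h1); rewrite -mulrA; apply: ler_wpM2l => //.
apply: (le_trans dq); apply: ler_wpM2l => //.
by rewrite -[leRHS]expr1; apply: ler_wiXn2l => //; rewrite ?expn_gt0.
Qed.

End Projection.

(** * The bound *)

Section FinalBound.
Context {R : realType}.
Implicit Types (q r e : quad R) (n : nat).

Lemma powR_root_pow (e : R) (N : nat) : 0 <= e -> (0 < N)%N ->
  (e `^ (N%:R^-1)) ^+ N = e.
Proof.
move=> e0 N0; rewrite -powR_mulrn ?powR_ge0 // -powRrM mulVf ?powRr1 //.
by rewrite pnatr_eq0 -lt0n.
Qed.

Lemma two_bounds_of_unit n (a b c d : {poly R}) :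
  inQ n (a, b, c, d) -> qM (a, b, c, d) = 1 ->
  a ^+ 2 + b ^+ 2 * w = 1 - c ^+ 2 - d ^+ 2 * w /\
  two_bounds (2 * n) (a ^+ 2 + b ^+ 2 * w).
Proof.
move=> [sa sb sc sd] h.
have e : a ^+ 2 + b ^+ 2 * w = 1 - c ^+ 2 - d ^+ 2 * w by rewrite -h /qM; ring.
split=> //; split.
  rewrite mul2n -addnn !expr2; apply: size_add_le.
    by apply: (size_mul_le sa sa); rewrite addnS.
  case: n sb {sa sc sd} => [|n] sb.
    by move/size_poly_leq0P: sb => ->; rewrite !mul0r size_poly0.
  apply: (size_mul_le (size_mul_le sb sb (leqnn _)) size_w).
  by rewrite addn3 !(addSn, addnS).
move=> x x01; have w0 := w_ge0 x01.
have := horner_qM a b c d x; rewrite h hornerC.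
have := horner_qM a b 0 0 x; rewrite /qM !expr0n /= mul0r !addr0 !horner0.
rewrite expr0n /= mul0r !addr0 => ->.
have := sqr_ge0 a.[x]; have := mulr_ge0 (sqr_ge0 b.[x]) w0.
have := sqr_ge0 c.[x]; have := mulr_ge0 (sqr_ge0 d.[x]) w0.
by move=> *; apply/andP; split; lra.
Qed.

Lemma wnorm_sub_le (a b c d a' b' c' d' : {poly R}) :
  wnorm ((a ^+ 2 + b ^+ 2 * w) - (a' ^+ 2 + b' ^+ 2 * w)) <=
  qnorm ((a, b, c, d) - (a', b', c', d') : quad R) *
  (qnorm (a, b, c, d) + qnorm (a', b', c', d')).
Proof.
have -> : (a ^+ 2 + b ^+ 2 * w) - (a' ^+ 2 + b' ^+ 2 * w)
    = qB (a - a', b - b', 0, 0) (a + a', b + b', 0, 0).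
  by rewrite /qB; ring.
apply: (le_trans (wnorm_qB _ _)).
have drop (y z y' z' : {poly R}) : qnorm (y, z, 0, 0) <= qnorm (y, z, y', z').
  apply: le_qnorm => x x01; rewrite !horner_qM !horner0 expr0n /= mul0r !addr0.
  have := sqr_ge0 y'.[x]; have := mulr_ge0 (sqr_ge0 z'.[x]) (w_ge0 x01).
  by move=> *; lra.
apply: ler_pM; rewrite ?qnorm_ge0 //; first exact: (drop _ _ (c - c') (d - d')).
have h := drop (a + a') (b + b') (c + c') (d + d').
have e : (a + a', b + b', c + c', d + d')
    = (a, b, c, d) + (a', b', c', d') :> quad R by [].
by rewrite e in h; exact: le_trans h (qnormD _ _).
Qed.

End FinalBound.

Theorem corollary4p2 (R : realType) (H : R) (H_gt0 : 0 < H) :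
  exists2 C : R, 0 < C &
    forall (chi6 : 'cV[R]_6 -> 'cV[R]_6) (chi8 : 'cV[R]_8 -> 'cV[R]_8),
      correction (A6 R) (B6 R) (S6 R) chi6 ->
      correction (A8 R) (B8 R) (S8 R) chi8 ->
    forall (n : nat) (a b c d ta tb tc td : {poly R}),
      inQ n (a, b, c, d) ->
      qnorm (a, b, c, d) <= H ->
      quad_proj chi6 chi8 n (a, b, c, d) = (ta, tb, tc, td) ->
      let p0 := a ^+ 2 + b ^+ 2 * w in
      let p1 := 1 - c ^+ 2 - d ^+ 2 * w in
      let tp := ta ^+ 2 + tb ^+ 2 * w in
      [/\ tp = 1 - tc ^+ 2 - td ^+ 2 * w,
          two_bounds (2 * n) tp
        & wnorm (p0 - tp) <=
            n.+1%:R * C *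
            Num.max (wnorm (p0 - p1))
                    (wnorm (p0 - p1) `^ (2 ^- (2 * n + 1)))].
Proof.
pose K : R := 26 * (H ^+ 2 + pi + 1) + 10 * H + 1.
(* [G] bounds the sum of the norms of [q] and of its projection, the latter being
   [sqrt pi]. *)
pose G : R := H + Num.sqrt pi.
have H0 : 0 <= H := ltW H_gt0.
have pi0 : 0 <= pi :> R := pi_ge0 R.
have G0 : 0 < G by rewrite ltr_wpDr ?sqrtr_ge0.
have K1 : 1 <= K.
  rewrite lerDr; apply: addr_ge0; apply: mulr_ge0 => //.
  by do 2! apply: addr_ge0 => //; exact: sqr_ge0.
have K0 : 0 <= K by apply: le_trans K1.
have KG0 : 0 <= 5 * K * G by rewrite !mulr_ge0 // ltW.
exists (5 * K * G + G ^+ 2); first by rewrite ltr_wpDl // exprn_gt0.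
move=> chi6 chi8 corr6 corr8 n a b c d ta tb tc td sq qH eq p0 p1 tp.
pose q : quad R := (a, b, c, d); pose tq : quad R := (ta, tb, tc, td).
have [] := quad_proj_unit corr6 corr8 sq; rewrite eq => stq Mtq.
have [e1 tb2] := two_bounds_of_unit stq Mtq; split=> //.
have eD : wnorm (p0 - p1) = defect q.
  by congr wnorm; rewrite /p0 /p1 /q /qM; ring.
rewrite eD; set e := defect q.
have e0 : 0 <= e := wnorm_ge0 _.
have tqn : qnorm tq = Num.sqrt pi by rewrite /qnorm wnorm_qM Mtq wint1.
have n1 : 1 <= n.+1%:R :> R by rewrite ler1n.
have hG : wnorm (p0 - tp) <= qnorm (q - tq) * G.
  apply: (le_trans (wnorm_sub_le _ _ c d _ _ tc td)).
  by apply: ler_wpM2l; rewrite ?qnorm_ge0 // tqn lerD2r.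
(* For [e > 1] the maximum is at least 1, and a bound free of [e] suffices. *)
apply: (le_trans hG); have [ele1|elt1] := leP e 1; last first.
  apply: (@le_trans _ _ (G ^+ 2)).
    rewrite expr2 ler_pM2r //; apply: (le_trans (qnormD _ _)).
    by rewrite qnormN tqn lerD2r.
  apply: (@le_trans _ _ (n.+1%:R * (5 * K * G + G ^+ 2) * 1)).
    rewrite mulr1; apply: (@le_trans _ _ (1 * (5 * K * G + G ^+ 2))).
      by rewrite mul1r lerDr.
    by apply: ler_wpM2r => //; rewrite addr_ge0 ?sqr_ge0.
  apply: ler_wpM2l; first by rewrite mulr_ge0 ?addr_ge0 ?sqr_ge0.
  by rewrite le_max (ltW elt1).
set x := e `^ _.
have xe : x ^+ (2 ^ (2 * n + 1)) = e.
  by rewrite /x -natrX powR_root_pow // expn_gt0.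
have x0 : 0 <= x := powR_ge0 _ _.
have x1 : x <= 1.
  by rewrite -(@expr_le1 _ (2 ^ (2 * n + 1))) ?expn_gt0 // xe.
have dx : Num.sqrt (defect q) <= K * x ^+ (2 ^ n).
  have xn0 : 0 <= x ^+ (2 ^ n) by apply: exprn_ge0.
  apply: (@le_trans _ _ (x ^+ (2 ^ n))); last by rewrite ler_peMl.
  rewrite -[leRHS](ger0_norm xn0) -sqrtr_sqr; apply: ler_wsqrtr.
  rewrite -/e -xe -exprM -expnSr; apply: ler_wiXn2l => //.
  by rewrite leq_exp2l // addn1 ltnS leq_pmull.
have x01 : 0 <= x <= 1 by rewrite x0.
have := proj_dist corr6 corr8 H0 sq (fun=> qH) x01 dx; rewrite eq => hd.
apply: (le_trans (ler_wpM2r (ltW G0) hd)).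
apply: (@le_trans _ _ (n.+1%:R * (5 * K * G + G ^+ 2) * x)).
  have -> : n.+1%:R * (5 * K * x) * G = n.+1%:R * (5 * K * G) * x by ring.
  apply: ler_wpM2r => //; apply: ler_wpM2l => //.
  by rewrite lerDl sqr_ge0.
apply: ler_wpM2l; first by rewrite mulr_ge0 ?addr_ge0 ?sqr_ge0.
by rewrite le_max lexx orbT.
Qed.
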